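(* Let $K$ be a field and let $\mathcal{G}$ be an ultragraph without sinks. Then the set $$\{V_{r(x)}\mid x\in Y_\infty\}\ \cup\ \{V_{[p]}\mid p\in\mathfrak{p}^\infty_{irr}\}\ \cup\ \{V^f_{[p]}\mid p\in\mathfrak{p}^\infty_{rat},\ [f]\in\mathrm{Irr}(K[t,t^{-1}])/\!\equiv\}$$ consists of pairwise non-isomorphic simple left $L_K(\mathcal{G})$-modules. (Here the members are indexed by the distinct sets $r(x)$, the distinct classes $[p]$ of irrational paths, and the distinct pairs $([p],[f])$ of a class of rational paths and a class of irreducible Laurent polynomials, respectively.)
   Context: Ultragraphs. An ultragraph $\mathcal{G}=(G^0,\mathcal{G}^1,r,s)$ consists of a countable set $G^0$ of vertices, a countable set $\mathcal{G}^1$ of edges, and maps $s:\mathcal{G}^1\to G^0$, $r:\mathcal{G}^1\to\mathcal{P}(G^0)\setminus\{\varnothing\}$. A vertex $v$ is a sink if $s^{-1}(v)=\varnothing$, and regular if $0<|s^{-1}(v)|<\infty$. $\mathcal{G}^0$ is the smallest subset of $\mathcal{P}(G^0)$ containing all $\{v\}$ and all $r(e)$ and closed under finite unions and finite intersections. A finite path is either an element $A\in\mathcal{G}^0$ (length $0$, $s(A)=r(A)=A$) or a sequence $\alpha=e_1\cdots e_n$ of edges with $s(e_{i+1})\in r(e_i)$ (length $n$, $s(\alpha)=s(e_1)$, $r(\alpha)=r(e_n)$); $\mathcal{G}^*$ is the set of finite paths. A cycle is a path $\alpha$ of length $\ge1$ with $s(\alpha)\in r(\alpha)$. $\mathfrak{p}^\infty$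 is the set of infinite paths, i.e. sequences $e_1e_2\cdots$ of edges with $s(e_{i+1})\in r(e_i)$ for all $i$ (source $s(e_1)$); $\tau_{>n}(e_1e_2\cdots)=e_{n+1}e_{n+2}\cdots$. Leavitt path algebra. $L_K(\mathcal{G})$ is the $K$-algebra generated by $\{s_e,s_e^*: e\in\mathcal{G}^1\}\cup\{p_A: A\in\mathcal{G}^0\}$ subject to, for all $A,B\in\mathcal{G}^0$, $e,f\in\mathcal{G}^1$: (1) $p_\varnothing=0$, $p_Ap_B=p_{A\cap B}$, $p_{A\cup B}=p_A+p_B-p_{A\cap B}$; (2) $p_{s(e)}s_e=s_e=s_ep_{r(e)}$ and $p_{r(e)}s_e^*=s_e^*=s_e^*p_{s(e)}$; (3) $s_e^*s_f=\delta_{e,f}p_{r(e)}$; (4) $p_v=\sum_{s(e)=v}s_es_e^*$ for every regular vertex $v$ (with $p_v:=p_{\{v\}}$). Ultrapaths. $\mathfrak{p}=\mathcal{G}^0\sqcup\{(\alpha,A):\alpha\in\mathcal{G}^*,|\alpha|\ge1,A\in\mathcal{G}^0,A\subseteq r(\alpha)\}$, with $r((\alpha,A))=A$, $s((\alpha,A))=s(\alpha)$, and $r(A)=s(A)=A$ for $A\in\mathcal{G}^0$. A filter in $\mathcal{G}^0$ is a subset of $\mathcal{G}^0$ not containing $\varnothing$, closed under intersections and under supersets in $\mathcal{G}^0$; an ultrafilter is a filter not properly contained in any filter; $A\in\mathcal{G}^0$ is an ultraset if $\{B\in\mathcal{G}^0:A\subseteq B\}$ is an ultrafilter. $Y_\infty$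 is the set of $y\in\mathfrak{p}$ such that $r(y)$ is an ultraset emitting infinitely many edges (i.e. $\{e: s(e)\in r(y)\}$ is infinite). Module $V_{r(x)}$, $x\in Y_\infty$: the $K$-vector space with basis $\{y\in\mathfrak{p}: r(y)=r(x)\}$ and action $p_A\cdot y=y$ if $s(y)\in A$ and $0$ otherwise; $s_e\cdot(e_1\cdots e_n,r(x))=(ee_1\cdots e_n,r(x))$ if $s(e_1)\in r(e)$ and $0$ otherwise; $s_e^*\cdot(e_1\cdots e_n,r(x))=(e_2\cdots e_n,r(x))$ if $e=e_1$ (meaning $r(x)$ if $n=1$) and $0$ otherwise; for the length-zero basis element $y=r(x)$: $s_e\cdot r(x)=(e,r(x))$ if $r(x)\subseteq r(e)$ and $0$ otherwise, $s_e^*\cdot r(x)=0$, and ''$s(y)\in A$'' means $r(x)\subseteq A$. Infinite paths: $p\sim q$ if $\tau_{>m}(p)=\tau_{>n}(q)$ for some $m,n\ge0$; $[p]$ is the $\sim$-class. $p$ is rational if $p\sim c^\infty:=ccc\cdots$ for some cycle $c$, irrational otherwise; the sets of such paths are $\mathfrak{p}^\infty_{rat}$, $\mathfrak{p}^\infty_{irr}$. Module $V_{[p]}$, $p$ irrational: the $K$-vector space with basis $[p]$ and action, for $q=e_1e_2\cdots\in[p]$: $p_A\cdot q=q$ if $s(q)\in A$ and $0$ otherwise; $s_e\cdot q=eq$ if $s(q)\in r(e)$ and $0$ otherwise; $s_e^*\cdot q=\tau_{>1}(q)$ if $e=e_1$ and $0$ otherwise. Module $V^f_{[p]}$, $p$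 rational, $f$ an irreducible element of $K[t,t^{-1}]$: fix for the class $[p]$ a cycle $c$ of least possible length with $p\sim c^\infty$. Let $M_c$ be the $K$-vector space with basis all triples $(q,k,c^\infty)$ such that $q\in[c^\infty]$, $k\in\mathbb{Z}$ and there are $m,n\ge0$ with $k=m-n$ and $\tau_{>m}(q)=\tau_{>n}(c^\infty)$. It is a left $L_K(\mathcal{G})$-module via $p_A\cdot(q,k,c^\infty)=(q,k,c^\infty)$ if $s(q)\in A$, else $0$; $s_e\cdot(q,k,c^\infty)=(eq,k+1,c^\infty)$ if $s(q)\in r(e)$, else $0$; $s_e^*\cdot(q,k,c^\infty)=(\tau_{>1}(q),k-1,c^\infty)$ if $q$ begins with $e$, else $0$; and a right $K[t,t^{-1}]$-module via $(q,k,c^\infty)\cdot t=(q,k+|c|,c^\infty)$. Then $V^f_{[p]}:=M_c\otimes_{K[t,t^{-1}]}K[t,t^{-1}]/(f)$. $\mathrm{Irr}(K[t,t^{-1}])$ is the set of irreducible elements; $f\equiv g$ iff $f=ug$ for a unit $u$ of $K[t,t^{-1}]$; $[f]$ is the $\equiv$-class. *)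

(* Defs.v *)
From HB Require Import structures.
From mathcomp Require Import all_boot all_order all_algebra finmap.
From mathcomp Require Import boolp classical_sets cardinality.
From mathcomp Require Import monalg.

Set Implicit Arguments.
Unset Strict Implicit.
Unset Printing Implicit Defensive.

Import GRing.Theory.
Local Open Scope classical_set_scope.
Local Open Scope ring_scope.
Local Open Scope quotient_scope.

(* {malg R[T]} is the free R-module on T, with basis elements << y >>; [lext f]
   is the R-linear extension of f : T -> V. *)
Section LinearExtension.
Context {R : nzRingType} {T : choiceType} {V : lmodType R}.

Definition lext (f : T -> V) (x : {malg R[T]}) : V :=
  \sum_(y <- msupp x) x@_y *: f y.

Lemma lextEw (f : T -> V) (d : {fset T}) (x : {malg R[T]}) :
  (msupp x `<=` d)%fset -> lext f x = \sum_(y <- d) x@_y *: f y.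
Proof.
move=> le; rewrite /lext (big_fset_incl _ le) // => y _ yN.
by rewrite mcoeff_outdom // scale0r.
Qed.

Fact lext_is_linear (f : T -> V) : linear (lext f).
Proof.
move=> a x y; pose d := (msupp x `|` msupp y `|` msupp (a *: x + y))%fset.
have sx : (msupp x `<=` d)%fset.
  by apply: fsubset_trans (fsubsetUl _ _); exact: fsubsetUl.
have sy : (msupp y `<=` d)%fset.
  by apply: fsubset_trans (fsubsetUl _ _); exact: fsubsetUr.
have sxy : (msupp (a *: x + y) `<=` d)%fset by exact: fsubsetUr.
rewrite (lextEw _ sx) (lextEw _ sy) (lextEw _ sxy) scaler_sumr -big_split /=.
by apply: eq_bigr => i _; rewrite mcoeffD mcoeffZ scalerDl scalerA.
Qed.

HB.instance Definition _ (f : T -> V) :=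
  GRing.isLinear.Build R {malg R[T]} V *:%R (lext f) (lext_is_linear f).

Lemma lextU (f : T -> V) (y : T) : lext f << y >> = f y.
Proof.
rewrite /lext msuppU oner_eq0 big_seq_fset1.
by rewrite mcoeffUU scale1r.
Qed.

Lemma malg_ind (P : {malg R[T]} -> Prop) :
  P 0 -> (forall x y, P x -> P y -> P (x + y)) ->
  (forall c x, P x -> P (c *: x)) -> (forall y, P << y >>) -> forall x, P x.
Proof.
move=> P0 PD PZ PU x; rewrite [x]monalgE; elim/big_ind: _ => // y _.
suff -> : << x@_y *g y >> = x@_y *: << y >> :> {malg R[T]} by exact/PZ/PU.
by apply/malgP => k; rewrite mcoeffZ !mcoeffU mulrnAr mulr1.
Qed.

Lemma lext_ext (f g : {linear {malg R[T]} -> V}) :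
  (forall y, f << y >> = g << y >>) -> f =1 g.
Proof.
move=> fg x; elim/malg_ind: x => [|x y hx hy|c x hx|//].
- by rewrite !linear0.
- by rewrite !linearD hx hy.
- by rewrite !linearZ_LR hx.
Qed.

Lemma eq_lext (f g : T -> V) : f =1 g -> lext f =1 lext g.
Proof. by move=> fg x; apply: eq_bigr => y _; rewrite fg. Qed.

Lemma lextDf (f g : T -> V) x :
  lext (fun y => f y + g y) x = lext f x + lext g x.
Proof. by rewrite -big_split /=; apply: eq_bigr => y _; rewrite scalerDr. Qed.

End LinearExtension.

Lemma linear_lext (R : nzRingType) (T : choiceType) (V W : lmodType R)
    (f : {linear V -> W}) (g : T -> V) (x : {malg R[T]}) :
  f (lext g x) = lext (f \o g) x.
Proof.
by rewrite linear_sum /=; apply: eq_bigr => y _; rewrite linearZ_LR.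
Qed.


Section SpanQuotient.
Context {R : nzRingType} {V : lmodType R} (S : set V).

Inductive span : V -> Prop :=
| span_gen v : S v -> span v
| span_0 : span 0
| span_D u v : span u -> span v -> span (u + v)
| span_Z a v : span v -> span (a *: v).

Lemma span_N v : span v -> span (- v).
Proof. by rewrite -scaleN1r; exact: span_Z. Qed.

Definition span_rel (u v : V) : bool := `[< span (u - v) >].

Fact span_rel_equiv : equiv_class_of span_rel.
Proof.
split=> [u|u v|v u w /asboolP uv /asboolP vw].
- by apply/asboolP; rewrite subrr; exact: span_0.
- by apply/asboolP/asboolP => /span_N; rewrite opprB.
- apply/asboolP; rewrite -(subrKA v); exact: span_D.
Qed.
Canonical span_rel_equivrel := EquivRelPack span_rel_equiv.

Definition quot := {eq_quot span_rel}.
HB.instance Definition _ := Choice.on quot.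
HB.instance Definition _ := EqQuotient.on quot.

End SpanQuotient.

HB.lock Definition qpi (R : nzRingType) (V : lmodType R) (S : set V) (v : V) : quot S :=
  \pi_(quot S) v.

Section SpanQuotientTheory.
Context {R : nzRingType} {V : lmodType R} (S : set V).
Notation span := (@span R V S).
Notation quot := (@quot R V S).
Notation qpi := (@qpi R V S).

Lemma qpiP u v : qpi u = qpi v <-> span (u - v).
Proof.
rewrite unlock; split=> [/eqP|h]; first by rewrite piE => /asboolP.
by apply/eqP; rewrite piE; apply/asboolP.
Qed.

Lemma qreprP v : span (repr (qpi v) - v).
Proof. by apply/qpiP; rewrite unlock reprK. Qed.

Lemma quotW (P : quot -> Prop) : (forall v, P (qpi v)) -> forall x, P x.
Proof. by move=> h x; rewrite -[x]reprK; have := h (repr x); rewrite unlock. Qed.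

Definition qzero : quot := qpi 0.
Definition qopp (x : quot) : quot := qpi (- repr x).
Definition qadd (x y : quot) : quot := qpi (repr x + repr y).
Definition qscale (a : R) (x : quot) : quot := qpi (a *: repr x).

Lemma qoppE v : qopp (qpi v) = qpi (- v).
Proof. by apply/qpiP; rewrite opprK addrC -opprB; exact/span_N/qreprP. Qed.

Lemma qaddE u v : qadd (qpi u) (qpi v) = qpi (u + v).
Proof. by apply/qpiP; rewrite opprD addrACA; apply: span_D; exact: qreprP. Qed.

Lemma qscaleE a v : qscale a (qpi v) = qpi (a *: v).
Proof. by apply/qpiP; rewrite -scalerBr; apply: span_Z; exact: qreprP. Qed.

Fact qaddA : associative qadd.
Proof. by elim/quotW=> x; elim/quotW=> y; elim/quotW=> z; rewrite !qaddE addrA. Qed.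
Fact qaddC : commutative qadd.
Proof. by elim/quotW=> x; elim/quotW=> y; rewrite !qaddE addrC. Qed.
Fact qadd0 : left_id qzero qadd.
Proof. by elim/quotW=> x; rewrite !qaddE add0r. Qed.
Fact qaddN : left_inverse qzero qopp qadd.
Proof. by elim/quotW=> x; rewrite qoppE qaddE addNr. Qed.

HB.instance Definition _ := GRing.isZmodule.Build quot qaddA qaddC qadd0 qaddN.

Fact qscaleA a b x : qscale a (qscale b x) = qscale (a * b) x.
Proof. by elim/quotW: x => x; rewrite !qscaleE scalerA. Qed.
Fact qscale1 : left_id 1 qscale.
Proof. by elim/quotW=> x; rewrite qscaleE scale1r. Qed.
Fact qscaleDr : right_distributive qscale +%R.
Proof.
move=> a; elim/quotW=> x; elim/quotW=> y.
by rewrite [_ + _]qaddE !qscaleE [RHS]qaddE scalerDr.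
Qed.
Fact qscaleDl x : {morph qscale^~ x : a b / a + b}.
Proof. by elim/quotW: x => x a b; rewrite !qscaleE [RHS]qaddE scalerDl. Qed.

HB.instance Definition _ := GRing.Zmodule_isLmodule.Build R quot
  qscaleA qscale1 qscaleDr qscaleDl.

Fact qpi_is_linear : linear qpi.
Proof.
by move=> a u v; rewrite -[a *: qpi u]/(qscale a (qpi u)) qscaleE -qaddE.
Qed.
HB.instance Definition _ := GRing.isLinear.Build R V quot *:%R qpi qpi_is_linear.

End SpanQuotientTheory.

(* M (x)_R N, as an abelian group, for modules over a commutative ring R (so
   that M is both a left and a right module). *)
Section Tensor.
Context {R : comNzRingType} (M N : lmodType R).

Inductive tensor_rel : {malg int[(M * N)%type]} -> Prop :=
| tensor_Dl m m' n :
    tensor_rel (<< (m + m', n) >> - (<< (m, n) >> + << (m', n) >>))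
| tensor_Dr m n n' :
    tensor_rel (<< (m, n + n') >> - (<< (m, n) >> + << (m, n') >>))
| tensor_bal m (a : R) n :
    tensor_rel (<< (a *: m, n) >> - << (m, a *: n) >>).

Definition tensor := quot tensor_rel.
HB.instance Definition _ := GRing.Zmodule.on tensor.

Definition tpure (m : M) (n : N) : tensor := qpi tensor_rel << (m, n) >>.

End Tensor.

(* phi (x) id, for phi an R-linear endomorphism of M *)
Definition tmap_free (R : comNzRingType) (M N : lmodType R) (phi : M -> M) :
    {malg int[(M * N)%type]} -> {malg int[(M * N)%type]} :=
  lext (fun z => << (phi z.1, z.2) >>).

HB.lock Definition tmap (R : comNzRingType) (M N : lmodType R) (phi : M -> M)
    (x : tensor M N) : tensor M N :=
  qpi (@tensor_rel R M N) (tmap_free phi (repr x)).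

Section TensorTheory.
Context {R : comNzRingType} (M N : lmodType R).
Notation tensor := (tensor M N).
Notation tensor_rel := (@tensor_rel R M N).
Notation tmap_free := (@tmap_free R M N).
Notation tmap := (@tmap R M N).
Notation tpure := (@tpure R M N).

Lemma tmap_freeU phi m n : tmap_free phi << (m, n) >> = << (phi m, n) >>.
Proof. exact: lextU. Qed.

Lemma tmap_freeD phi x y :
  tmap_free phi (x + y) = tmap_free phi x + tmap_free phi y.
Proof. exact: linearD. Qed.

Lemma tmap_freeB phi x y :
  tmap_free phi (x - y) = tmap_free phi x - tmap_free phi y.
Proof. exact: linearB. Qed.

Lemma tensorW (P : tensor -> Prop) :
  (forall v, P (qpi tensor_rel v)) -> forall x, P x.
Proof. exact: quotW. Qed.

Lemma tmap_free_span (phi : {linear M -> M}) x :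
  span tensor_rel x -> span tensor_rel (tmap_free phi x).
Proof.
elim=> {x}.
- move=> _ [m m' n|m n n'|m a n]; rewrite tmap_freeB ?tmap_freeD !tmap_freeU.
  + rewrite linearD; exact/span_gen/tensor_Dl.
  + exact/span_gen/tensor_Dr.
  + rewrite linearZ; exact/span_gen/tensor_bal.
- by rewrite /tmap_free linear0; exact: span_0.
- by move=> u v _ hu _ hv; rewrite tmap_freeD; exact: span_D.
- by move=> a v _ hv; rewrite /tmap_free linearZ; exact: span_Z.
Qed.

Lemma tmapE (phi : {linear M -> M}) x :
  tmap phi (qpi tensor_rel x) = qpi tensor_rel (tmap_free phi x).
Proof.
rewrite tmap.unlock; apply/qpiP; rewrite -tmap_freeB; apply: tmap_free_span; exact: qreprP.
Qed.

Lemma tmap_pure (phi : {linear M -> M}) m n :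
  tmap phi (tpure m n) = tpure (phi m) n.
Proof. by rewrite tmapE tmap_freeU. Qed.

Lemma tmap_additive (phi : {linear M -> M}) : {morph tmap phi : x y / x + y}.
Proof.
elim/tensorW=> x; elim/tensorW=> y.
by rewrite -linearD !tmapE tmap_freeD linearD.
Qed.

Lemma tensor_ind (P : tensor -> Prop) :
  (forall m n, P (tpure m n)) -> P 0 ->
  (forall x y, P x -> P y -> P (x + y)) -> (forall x, P x -> P (- x)) ->
  forall x, P x.
Proof.
move=> Pp P0 PD PN; apply: tensorW; apply: malg_ind => [|x y hx hy|c x hx|[m n]].
- by rewrite linear0.
- by rewrite linearD; exact: PD.
- rewrite linearZ /=; set z := qpi _ x in hx *.
  have hn n : P (n%:Z *: z).
    elim: n => [|n IH]; first by rewrite scale0r.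
    by rewrite -addn1 PoszD scalerDl scale1r; exact: PD.
  case: c => n; first exact: hn.
  by rewrite NegzE scaleNr; exact/PN/hn.
- exact: Pp.
Qed.

Lemma tpureDl m m' n : tpure (m + m') n = tpure m n + tpure m' n.
Proof.
rewrite /tpure -linearD; apply/qpiP; exact/span_gen/tensor_Dl.
Qed.

End TensorTheory.

Inductive algterm (K X : Type) : Type :=
| tgen of X
| tzero
| topp of algterm K X
| tadd of algterm K X & algterm K X
| tscale of K & algterm K X
| tmul of algterm K X & algterm K X.

Arguments tgen {K X} _.
Arguments tzero {K X}.

Section Presentation.
Context {K : nzRingType} {X : Type} (rel : algterm K X -> algterm K X -> Prop).
Notation term := (algterm K X).

HB.instance Definition _ := gen_eqMixin (algterm K X).
HB.instance Definition _ := gen_choiceMixin (algterm K X).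

(* The least congruence containing rel whose quotient is an associative
   K-algebra. *)
Inductive pcong : term -> term -> Prop :=
| pc_rel x y : rel x y -> pcong x y
| pc_refl x : pcong x x
| pc_sym x y : pcong x y -> pcong y x
| pc_trans x y z : pcong x y -> pcong y z -> pcong x z
| pc_opp x x' : pcong x x' -> pcong (topp x) (topp x')
| pc_add x x' y y' : pcong x x' -> pcong y y' -> pcong (tadd x y) (tadd x' y')
| pc_scale a x x' : pcong x x' -> pcong (tscale a x) (tscale a x')
| pc_mul x x' y y' : pcong x x' -> pcong y y' -> pcong (tmul x y) (tmul x' y')
| pc_addA x y z : pcong (tadd x (tadd y z)) (tadd (tadd x y) z)
| pc_addC x y : pcong (tadd x y) (tadd y x)
| pc_add0 x : pcong (tadd tzero x) x
| pc_addN x : pcong (tadd (topp x) x) tzero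
| pc_scaleA a b x : pcong (tscale a (tscale b x)) (tscale (a * b) x)
| pc_scale1 x : pcong (tscale 1 x) x
| pc_scaleDr a x y :
    pcong (tscale a (tadd x y)) (tadd (tscale a x) (tscale a y))
| pc_scaleDl a b x :
    pcong (tscale (a + b) x) (tadd (tscale a x) (tscale b x))
| pc_mulA x y z : pcong (tmul x (tmul y z)) (tmul (tmul x y) z)
| pc_mulDl x y z : pcong (tmul (tadd x y) z) (tadd (tmul x z) (tmul y z))
| pc_mulDr x y z : pcong (tmul x (tadd y z)) (tadd (tmul x y) (tmul x z))
| pc_scaleAl a x y : pcong (tscale a (tmul x y)) (tmul (tscale a x) y)
| pc_scaleAr a x y : pcong (tscale a (tmul x y)) (tmul x (tscale a y)).

Definition pcongb (x y : term) : bool := `[< pcong x y >].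

Fact pcongb_equiv : equiv_class_of pcongb.
Proof.
split=> [x|x y|y x z /asboolP xy /asboolP yz].
- by apply/asboolP; exact: pc_refl.
- by apply/asboolP/asboolP; exact: pc_sym.
- by apply/asboolP; exact: pc_trans yz.
Qed.
Canonical pcongb_equivrel := EquivRelPack pcongb_equiv.

Definition palg := {eq_quot pcongb}.
HB.instance Definition _ := Choice.on palg.
HB.instance Definition _ := EqQuotient.on palg.

Definition ppi (x : term) : palg := \pi_palg x.

Lemma ppiP x y : ppi x = ppi y <-> pcong x y.
Proof.
split=> [/eqP|h]; first by rewrite piE => /asboolP.
by apply/eqP; rewrite piE; apply/asboolP.
Qed.

Lemma preprP x : pcong (repr (ppi x)) x.
Proof. by apply/ppiP; rewrite /ppi reprK. Qed.

Lemma palgW (P : palg -> Prop) : (forall x, P (ppi x)) -> forall a, P a.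
Proof. by move=> h a; rewrite -[a]reprK; exact: h. Qed.

Definition pzero : palg := ppi tzero.
Definition popp (a : palg) : palg := ppi (topp (repr a)).
Definition padd (a b : palg) : palg := ppi (tadd (repr a) (repr b)).
Definition pscale (k : K) (a : palg) : palg := ppi (tscale k (repr a)).
Definition pmul (a b : palg) : palg := ppi (tmul (repr a) (repr b)).

Lemma poppE x : popp (ppi x) = ppi (topp x).
Proof. apply/ppiP/pc_opp; exact: preprP. Qed.
Lemma paddE x y : padd (ppi x) (ppi y) = ppi (tadd x y).
Proof. apply/ppiP/pc_add; exact: preprP. Qed.
Lemma pscaleE k x : pscale k (ppi x) = ppi (tscale k x).
Proof. apply/ppiP/pc_scale; exact: preprP. Qed.
Lemma pmulE x y : pmul (ppi x) (ppi y) = ppi (tmul x y).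
Proof. apply/ppiP/pc_mul; exact: preprP. Qed.

Let pE := (poppE, paddE, pscaleE, pmulE).

Fact paddA : associative padd.
Proof.
elim/palgW=> x; elim/palgW=> y; elim/palgW=> z; rewrite !pE.
exact/ppiP/pc_addA.
Qed.
Fact paddC : commutative padd.
Proof. elim/palgW=> x; elim/palgW=> y; rewrite !pE; exact/ppiP/pc_addC. Qed.
Fact padd0 : left_id pzero padd.
Proof. elim/palgW=> x; rewrite pE; exact/ppiP/pc_add0. Qed.
Fact paddN : left_inverse pzero popp padd.
Proof. elim/palgW=> x; rewrite !pE; exact/ppiP/pc_addN. Qed.

HB.instance Definition _ := GRing.isZmodule.Build palg paddA paddC padd0 paddN.

Lemma palgDE (a b : palg) : a + b = padd a b. Proof. by []. Qed.

Fact pscaleA k l x : pscale k (pscale l x) = pscale (k * l) x.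
Proof. elim/palgW: x => x; rewrite !pE; exact/ppiP/pc_scaleA. Qed.
Fact pscale1 : left_id 1 pscale.
Proof. elim/palgW=> x; rewrite pE; exact/ppiP/pc_scale1. Qed.
Fact pscaleDr : right_distributive pscale +%R.
Proof.
move=> k; elim/palgW=> x; elim/palgW=> y; rewrite !palgDE !pE.
exact/ppiP/pc_scaleDr.
Qed.
Fact pscaleDl x : {morph pscale^~ x : k l / k + l}.
Proof.
by elim/palgW: x => x k l; rewrite !palgDE !pE; exact/ppiP/pc_scaleDl.
Qed.

HB.instance Definition _ := GRing.Zmodule_isLmodule.Build K palg
  pscaleA pscale1 pscaleDr pscaleDl.

Lemma palgZE k (a : palg) : k *: a = pscale k a. Proof. by []. Qed.

Lemma pmulA : associative pmul.
Proof.
elim/palgW=> x; elim/palgW=> y; elim/palgW=> z; rewrite !pE.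
exact/ppiP/pc_mulA.
Qed.
Lemma pmulDl : left_distributive pmul +%R.
Proof.
elim/palgW=> x; elim/palgW=> y; elim/palgW=> z; rewrite !palgDE !pE.
exact/ppiP/pc_mulDl.
Qed.
Lemma pmulDr : right_distributive pmul +%R.
Proof.
elim/palgW=> x; elim/palgW=> y; elim/palgW=> z; rewrite !palgDE !pE.
exact/ppiP/pc_mulDr.
Qed.
Lemma pscaleAl k (x y : palg) : k *: pmul x y = pmul (k *: x) y.
Proof.
elim/palgW: x => x; elim/palgW: y => y; rewrite !palgZE !pE.
exact/ppiP/pc_scaleAl.
Qed.
Lemma pscaleAr k (x y : palg) : k *: pmul x y = pmul x (k *: y).
Proof.
elim/palgW: x => x; elim/palgW: y => y; rewrite !palgZE !pE.
exact/ppiP/pc_scaleAr.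
Qed.

(* Submodules and isomorphisms are those of modules over the (possibly nonunital)
   ring palg: K-linearity is not required. *)
Record lmodule := LModule {
  lm_sort :> zmodType;
  lm_act : palg -> lm_sort -> lm_sort;
  lm_actDr : forall a, {morph lm_act a : u v / u + v};
  lm_actDl : forall u, {morph lm_act^~ u : a b / a + b};
  lm_actA : forall a b u, lm_act (pmul a b) u = lm_act a (lm_act b u)
}.

Definition submodule (M : lmodule) (N : set M) : Prop :=
  [/\ N 0, forall u v, N u -> N v -> N (u - v)
    & forall a u, N u -> N (lm_act a u)].

Definition simple (M : lmodule) : Prop :=
  (exists a (u : M), lm_act a u <> 0) /\
  (forall N : set M, submodule N -> N = [set 0] \/ N = setT).

Definition isomorphic (M N : lmodule) : Prop :=
  exists phi : M -> N,
    [/\ {morph phi : u v / u + v},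
        forall a u, phi (lm_act a u) = lm_act a (phi u)
      & bijective phi].

(* The module on V in which each generator x acts by rho x. *)
Section Representation.
Context {V : lmodType K} (rho : X -> V -> V).

Fixpoint evalt (t : term) (u : V) : V :=
  match t with
  | tgen x => rho x u
  | tzero => 0
  | topp t => - evalt t u
  | tadd t1 t2 => evalt t1 u + evalt t2 u
  | tscale k t => k *: evalt t u
  | tmul t1 t2 => evalt t1 (evalt t2 u)
  end.

Definition ract (a : palg) : V -> V := evalt (repr a).

End Representation.
End Presentation.

Section RepresentationModule.
Context {K : comNzRingType} {X : Type}.
Context (rel : algterm K X -> algterm K X -> Prop) {V : lmodType K}.
Context (rho : X -> V -> V).
Hypothesis rho_lin : forall x, linear (rho x).
Hypothesis rho_rel : forall s t, rel s t -> evalt rho s =1 evalt rho t.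

Lemma evalt_linear t : linear (evalt rho t).
Proof.
elim: t => [x|||||] /=.
- exact: rho_lin.
- by move=> a u v; rewrite scaler0 addr0.
- by move=> t IH a u v; rewrite IH opprD scalerN.
- by move=> s hs t ht a u v; rewrite hs ht scalerDr addrACA.
- by move=> k t IH a u v; rewrite IH scalerDr !scalerA mulrC.
- by move=> s hs t ht a u v; rewrite ht hs.
Qed.

Lemma evalt_cong s t : pcong rel s t -> evalt rho s =1 evalt rho t.
Proof.
have ev0 r : evalt rho r 0 = 0.
  by have := evalt_linear r (-1) 0 0; rewrite scaler0 addr0 scaleN1r addNr.
have evD r u v : evalt rho r (u + v) = evalt rho r u + evalt rho r v.
  by have := evalt_linear r 1 u v; rewrite !scale1r.
have evZ r k u : evalt rho r (k *: u) = k *: evalt rho r u.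
  by have := evalt_linear r k u 0; rewrite ev0 !addr0.
elim=> {s t} /=.
- exact: rho_rel.
- by [].
- by move=> s t _ IH u; rewrite IH.
- by move=> r s t _ h1 _ h2 u; rewrite h1.
- by move=> s t _ IH u; rewrite IH.
- by move=> s s' t t' _ h1 _ h2 u; rewrite h1 h2.
- by move=> k s t _ IH u; rewrite IH.
- by move=> s s' t t' _ h1 _ h2 u; rewrite h2 h1.
- by move=> r s t u; rewrite addrA.
- by move=> s t u; rewrite addrC.
- by move=> s u; rewrite add0r.
- by move=> s u; rewrite addNr.
- by move=> k l s u; rewrite scalerA.
- by move=> s u; rewrite scale1r.
- by move=> k s t u; rewrite scalerDr.
- by move=> k l s u; rewrite scalerDl.
- by [].
- by [].
- by move=> r s t u; rewrite evD.
- by [].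
- by move=> k s t u; rewrite evZ.
Qed.

Lemma ractE t : ract rho (ppi rel t) =1 evalt rho t.
Proof. by apply: evalt_cong; exact: preprP. Qed.

Lemma ract_linear (a : palg rel) : linear (ract rho a).
Proof. exact: evalt_linear. Qed.

Fact ractDr (a : palg rel) : {morph ract rho a : u v / u + v}.
Proof. by move=> u v; have := ract_linear a 1 u v; rewrite !scale1r. Qed.

Fact ractDl (u : V) : {morph (fun a : palg rel => ract rho a u) : a b / a + b}.
Proof.
by apply: palgW => s; apply: palgW => t; rewrite palgDE paddE !ractE.
Qed.

Fact ractA (a b : palg rel) u : ract rho (pmul a b) u = ract rho a (ract rho b u).
Proof.
by move: a b; apply: palgW => s; apply: palgW => t; rewrite pmulE !ractE.
Qed.

Definition rep_module : lmodule rel := LModule ractDr ractDl ractA.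

End RepresentationModule.

Record ultragraph := Ultragraph {
  vertex : countType;
  edge : countType;
  source : edge -> vertex;
  rng : edge -> set vertex;
  rng_neq0 : forall e, rng e !=set0
}.

Section Ultragraph.
Context (G : ultragraph).
Notation V := (vertex G).
Notation E := (edge G).

Definition outs (v : V) : set E := [set e | source e = v].
Definition is_sink (v : V) : Prop := outs v = set0.
Definition no_sinks : Prop := forall v, ~ is_sink v.
Definition regular (v : V) : Prop := outs v <> set0 /\ finite_set (outs v).

(* The collection written G^0 with a calligraphic G; the empty set is the
   empty union. *)
Inductive genset : set V -> Prop :=
| gen_set0 : genset set0
| gen_vertex v : genset [set v]
| gen_range e : genset (rng e)
| gen_setU A B : genset A -> genset B -> genset (A `|` B)
| gen_setI A B : genset A -> genset B -> genset (A `&` B).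

Record gvertex := GVertex { gset :> set V; gsetP : genset gset }.

Definition gv0 : gvertex := GVertex gen_set0.
Definition gv1 (v : V) : gvertex := GVertex (gen_vertex v).
Definition gvr (e : E) : gvertex := GVertex (gen_range e).
Definition gvU (A B : gvertex) : gvertex := GVertex (gen_setU (gsetP A) (gsetP B)).
Definition gvI (A B : gvertex) : gvertex := GVertex (gen_setI (gsetP A) (gsetP B)).

Definition is_filter (F : set (set V)) : Prop :=
  [/\ F `<=` genset, ~ F set0,
      forall A B, F A -> F B -> F (A `&` B)
    & forall A B, F A -> genset B -> A `<=` B -> F B].

Definition is_ultrafilter (F : set (set V)) : Prop :=
  is_filter F /\ forall F', is_filter F' -> F `<=` F' -> F' = F.

Definition ultraset (A : set V) : Prop :=
  genset A /\ is_ultrafilter [set B | genset B /\ A `<=` B].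

Definition adj : rel E := fun e f => `[< rng e (source f) >].

(* The pair (l, A) with l != [::] is the ultrapath (l, A) of positive length,
   and ([::], A) is the ultrapath A of length 0. *)
Definition is_upath (l : seq E) (A : set V) : Prop :=
  [/\ sorted adj l, genset A
    & if l is e :: l' then A `<=` rng (last e l') else True].

Record upath := UPath {
  up_seq : seq E;
  up_rng : set V;
  up_ok : is_upath up_seq up_rng
}.

Definition Yinf : set upath :=
  [set y | ultraset (up_rng y) /\ infinite_set [set e | up_rng y (source e)]].

(* "s(y) in B" if y has positive length, "s(y) is included in B" otherwise *)
Definition up_src_in (y : upath) (B : set V) : Prop :=
  if up_seq y is e :: _ then B (source e) else up_rng y `<=` B.

Fact up_cons_ok e (y : upath) :
  up_src_in y (rng e) -> is_upath (e :: up_seq y) (up_rng y).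
Proof.
case: y => [[|f l] A [sl gA sA]]; rewrite /up_src_in /= => h; split => //=.
by apply/andP; split => //; apply/asboolP.
Qed.

Definition up_cons e y (h : up_src_in y (rng e)) : upath :=
  UPath (up_cons_ok h).

Fact up_tail_ok (y : upath) : is_upath (behead (up_seq y)) (up_rng y).
Proof.
case: y => [[|e [|f l]] A [sl gA sA]]; split => //=.
by move: sl => /= /andP[].
Qed.

Definition up_tail (y : upath) : upath := UPath (up_tail_ok y).

Lemma upath_eq (y z : upath) :
  up_seq y = up_seq z -> up_rng y = up_rng z -> y = z.
Proof.
case: y z => [l A p] [m B q] /= elm eAB; subst.
by rewrite (Prop_irrelevance p q).
Qed.

(* Infinite paths e_1 e_2 ... are indexed from 0. *)
Record ipath := IPath {
  ip_fun :> nat -> E;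
  ip_ok : forall i, rng (ip_fun i) (source (ip_fun i.+1))
}.

Lemma ipath_eq (p q : ipath) : (forall i, p i = q i) -> p = q.
Proof.
case: p q => [p hp] [q hq] /= /funext epq; subst.
by rewrite (Prop_irrelevance hp hq).
Qed.

Definition tau (n : nat) (p : ipath) : ipath :=
  @IPath (fun i => p (n + i)%N)
    (fun i => eq_ind_r (fun k => rng (p (n + i)%N) (source (p k)))
                       (ip_ok p (n + i)) (addnS n i)).

Definition ip_src (p : ipath) : V := source (p 0%N).

Fact ip_cons_ok e (p : ipath) : rng e (ip_src p) ->
  let q i := if i is j.+1 then p j else e in
  forall i, rng (q i) (source (q i.+1)).
Proof. by move=> h q [|i] //=; exact: ip_ok. Qed.

Definition ip_cons e (p : ipath) (h : rng e (ip_src p)) : ipath :=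
  IPath (ip_cons_ok h).

Lemma tau_add m n p : tau m (tau n p) = tau (n + m) p.
Proof. by apply: ipath_eq => i /=; rewrite addnA. Qed.

Lemma tau_cons n e p (h : rng e (ip_src p)) : tau n.+1 (ip_cons h) = tau n p.
Proof. exact: ipath_eq. Qed.

Definition ipeq (p q : ipath) : Prop := exists m n, tau m p = tau n q.

Lemma ipeq_refl p : ipeq p p. Proof. by exists 0%N, 0%N. Qed.
Lemma ipeq_sym p q : ipeq p q -> ipeq q p.
Proof. by move=> [m [n h]]; exists n, m. Qed.
Lemma ipeq_trans p q r : ipeq p q -> ipeq q r -> ipeq p r.
Proof.
move=> [m [n h]] [k [l h']]; exists (m + k)%N, (l + n)%N.
by rewrite -tau_add h tau_add addnC -tau_add h' tau_add.
Qed.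

Definition ip_class (p : ipath) : set ipath := [set q | ipeq q p].

Lemma ip_class_cons p e q (h : rng e (ip_src q)) :
  ip_class p q -> ip_class p (ip_cons h).
Proof. by move=> [m [n eq]]; exists m.+1, n; rewrite tau_cons. Qed.

Lemma ip_class_tau p n q : ip_class p q -> ip_class p (tau n q).
Proof.
by apply: ipeq_trans; exists 0%N, n; apply: ipath_eq => i /=; rewrite add0n.
Qed.

(* The cycle e_1 ... e_n is stored as e_1 and the list e_2 ... e_n. *)
Record ug_cycle := UgCycle {
  cy_head : E;
  cy_tail : seq E;
  cy_path : path adj cy_head cy_tail;
  cy_closed : rng (last cy_head cy_tail) (source cy_head)
}.

Definition cy_seq (c : ug_cycle) : seq E := cy_head c :: cy_tail c.
Definition cy_len (c : ug_cycle) : nat := size (cy_seq c).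

Definition cy_nth (c : ug_cycle) (i : nat) : E :=
  nth (cy_head c) (cy_seq c) (i %% cy_len c).

Fact cy_inf_ok c i : rng (cy_nth c i) (source (cy_nth c i.+1)).
Proof.
rewrite /cy_nth /cy_len; set n := size _.
have n0 : (0 < n)%N by [].
have := ltn_pmod i n0; rewrite leq_eqVlt => /orP[/eqP e|lt].
  have -> : (i.+1 %% n = 0)%N by rewrite -addn1 -modnDml addn1 e modnn.
  have -> : (i %% n = n.-1)%N by exact: (congr1 predn e).
  by rewrite /n nth_last /=; exact: cy_closed.
have -> : (i.+1 %% n = (i %% n).+1)%N.
  by rewrite -addn1 -modnDml addn1 modn_small.
move/(pathP (cy_head c)): (cy_path c) => /(_ (i %% n)%N lt) /asboolP.
by [].
Qed.

Definition cy_inf (c : ug_cycle) : ipath := IPath (cy_inf_ok c).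

Lemma tau_cy c n : tau (n + cy_len c) (cy_inf c) = tau n (cy_inf c).
Proof.
by apply: ipath_eq => i /=; rewrite /cy_nth -addnA addnCA -modnDml modnn.
Qed.

Definition rational (p : ipath) : Prop := exists c, ipeq p (cy_inf c).
Definition irrational (p : ipath) : Prop := ~ rational p.

Definition minimal_cycle (p : ipath) (c : ug_cycle) : Prop :=
  ipeq p (cy_inf c) /\
  forall d, ipeq p (cy_inf d) -> (cy_len c <= cy_len d)%N.

Record rpath := RPath { rp :> ipath; rpP : rational rp }.

(* A choice, for every class of rational paths, of a cycle of least length. *)
Record cycle_choice := CycleChoice {
  cyc :> rpath -> ug_cycle;
  cyc_min : forall p : rpath, minimal_cycle p (cyc p);
  cyc_class : forall p q : rpath, ipeq p q -> cyc p = cyc q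
}.

Lemma minimal_cycle_exists (p : rpath) : exists c, minimal_cycle p c.
Proof.
have [c0 hc0] := rpP p.
have ex : exists n, `[< exists2 c, ipeq p (cy_inf c) & cy_len c = n >].
  by exists (cy_len c0); apply/asboolP; exists c0.
case: (ex_minnP ex) => n /asboolP[c hc en] le; exists c; split => // d hd.
by rewrite en; apply: le; apply/asboolP; exists d.
Qed.

Lemma cycle_choice_exists : inhabited cycle_choice.
Proof.
pose ch (p : rpath) := cid (minimal_cycle_exists p).
have [f fP] : exists f : rpath -> ug_cycle, (forall p : rpath, minimal_cycle p (f p)) /\
    forall p q : rpath, ipeq p q -> f p = f q.
  have cl (p q : rpath) : ipeq p q -> minimal_cycle p = minimal_cycle q.
    move=> pq; apply/funext => c; apply/propext; split=> -[h1 h2]; split.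
    - exact: ipeq_trans (ipeq_sym pq) h1.
    - by move=> d hd; apply: h2; exact: ipeq_trans hd.
    - exact: ipeq_trans h1.
    - by move=> d hd; apply: h2; exact: ipeq_trans (ipeq_sym pq) hd.
  have sel (P : ug_cycle -> Prop) (h1 h2 : exists c, P c) :
    sval (cid h1) = sval (cid h2) by rewrite (Prop_irrelevance h1 h2).
  exists (fun p => sval (ch p)); split=> [p|p q pq]; first exact: svalP.
  rewrite /ch; move: (minimal_cycle_exists p) (minimal_cycle_exists q).
  by rewrite (cl _ _ pq) => h1 h2; exact: sel.
by case: fP => f1 f2; constructor; exact: CycleChoice f1 f2.
Qed.

End Ultragraph.

HB.instance Definition _ G := gen_eqMixin (ipath G).
HB.instance Definition _ G := gen_choiceMixin (ipath G).

Inductive lgen (G : ultragraph) : Type :=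
| gen_p of gvertex G
| gen_s of edge G
| gen_sstar of edge G.

Arguments gen_s {G} _.
Arguments gen_sstar {G} _.

Section Leavitt.
Context (K : fieldType) (G : ultragraph).
Notation p A := (@tgen K (lgen G) (gen_p A)).
Notation s e := (@tgen K (lgen G) (gen_s e)).
Notation s' e := (@tgen K (lgen G) (gen_sstar e)).

(* By lr_p0, including the empty set in the index set of the p_A is harmless. *)
Inductive leavitt_rel : algterm K (lgen G) -> algterm K (lgen G) -> Prop :=
| lr_p0 : leavitt_rel (p (gv0 G)) tzero
| lr_pI A B : leavitt_rel (tmul (p A) (p B)) (p (gvI A B))
| lr_pU A B :
    leavitt_rel (p (gvU A B)) (tadd (tadd (p A) (p B)) (topp (p (gvI A B))))
| lr_ps e : leavitt_rel (tmul (p (gv1 (source e))) (s e)) (s e)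
| lr_sp e : leavitt_rel (tmul (s e) (p (gvr e))) (s e)
| lr_ps' e : leavitt_rel (tmul (p (gvr e)) (s' e)) (s' e)
| lr_s'p e : leavitt_rel (tmul (s' e) (p (gv1 (source e)))) (s' e)
| lr_s's e : leavitt_rel (tmul (s' e) (s e)) (p (gvr e))
| lr_s's0 e f : e <> f -> leavitt_rel (tmul (s' e) (s f)) tzero
| lr_regular v : regular v ->
    leavitt_rel (p (gv1 v))
      (foldr (@tadd _ _) tzero [seq tmul (s e) (s' e) | e <- fset_set (outs v)]).

Definition leavitt : Type := palg leavitt_rel.
HB.instance Definition _ := GRing.Lmodule.on leavitt.
End Leavitt.

(* A set T with partial maps by which the generators act on the vector space
   with basis T (a basis vector being sent to 0 where the map is undefined). *)
Record basis_action (G : ultragraph) := BasisAction {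
  ba_sort :> choiceType;
  ba_p : set (vertex G) -> ba_sort -> Prop;
  ba_s : edge G -> ba_sort -> option ba_sort;
  ba_s' : edge G -> ba_sort -> option ba_sort;
  ba_p0 : forall y, ~ ba_p set0 y;
  ba_pI : forall A B y, ba_p (A `&` B) y <-> ba_p A y /\ ba_p B y;
  ba_pU : forall A B y, genset A -> genset B ->
    ba_p (A `|` B) y <-> ba_p A y \/ ba_p B y;
  ba_ps : forall e y z, ba_s e y = Some z -> ba_p [set source e] z;
  ba_sr : forall e y, (exists z, ba_s e y = Some z) <-> ba_p (rng e) y;
  ba_ss' : forall e y z, ba_s' e y = Some z <-> ba_s e z = Some y;
  ba_s's0 : forall e f y z, e <> f -> ba_s f y = Some z -> ba_s' e z = None;
  ba_reg : forall v y, regular v -> ba_p [set v] y ->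
    exists e z, source e = v /\ ba_s' e y = Some z
}.

Section BasisModule.
Context (K : fieldType) (G : ultragraph) (T : basis_action G).

Definition partial_lin (f : T -> option T) : {malg K[T]} -> {malg K[T]} :=
  lext (fun y => if f y is Some z then << z >> else 0).

Definition basis_rho (x : lgen G) : {malg K[T]} -> {malg K[T]} :=
  match x with
  | gen_p A => partial_lin (fun y => if `[< ba_p A y >] then Some y else None)
  | gen_s e => partial_lin (ba_s e)
  | gen_sstar e => partial_lin (ba_s' e)
  end.

Fact partial_lin_linear f : linear (partial_lin f).
Proof. exact: lext_is_linear. Qed.

HB.instance Definition _ f := GRing.isLinear.Build K {malg K[T]} {malg K[T]} *:%R
  (partial_lin f) (partial_lin_linear f).

Lemma partial_linU f y :
  partial_lin f << y >> = if f y is Some z then << z >> else 0.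
Proof. exact: lextU. Qed.

Lemma basis_rho_linear x : linear (basis_rho x).
Proof. by case: x => *; exact: partial_lin_linear. Qed.

Lemma basis_rho_rel s t :
  leavitt_rel s t -> evalt basis_rho s =1 evalt basis_rho t.
Proof.
move=> st.
have ext : (forall y, evalt basis_rho s << y >> = evalt basis_rho t << y >>) ->
    evalt basis_rho s =1 evalt basis_rho t.
  have L r : linear (evalt basis_rho r).
    by apply: evalt_linear; exact: basis_rho_linear.
  pose ms := GRing.isLinear.Build K {malg K[T]} {malg K[T]} *:%R _ (L s).
  pose mt := GRing.isLinear.Build K {malg K[T]} {malg K[T]} *:%R _ (L t).
  pose fs : {linear _ -> _} := HB.pack (evalt basis_rho s) ms.
  pose ft : {linear _ -> _} := HB.pack (evalt basis_rho t) mt.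
  exact: (lext_ext (f := fs) (g := ft)).
apply: ext => y; case: st => [|A B|A B|e|e|e|e|e|e f ef|v rv] /=.
- rewrite partial_linU; case: asboolP => // h; case: (ba_p0 h).
- rewrite !partial_linU.
  have -> : `[< ba_p (A `&` B) y >] = `[< ba_p A y >] && `[< ba_p B y >].
    apply/asboolP/andP => [/ba_pI[h1 h2]|[/asboolP h1 /asboolP h2]].
      by split; apply/asboolP.
    by apply/ba_pI.
  case hB: `[< ba_p B y >]; rewrite ?andbF ?andbT ?linear0 //.
  by rewrite partial_linU.
- rewrite !partial_linU.
  have -> : `[< ba_p (A `&` B) y >] = `[< ba_p A y >] && `[< ba_p B y >].
    apply/asboolP/andP => [/ba_pI[h1 h2]|[/asboolP h1 /asboolP h2]].
      by split; apply/asboolP.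
    by apply/ba_pI.
  have -> : `[< ba_p (A `|` B) y >] = `[< ba_p A y >] || `[< ba_p B y >].
    apply/asboolP/orP => [/ba_pU[||h|h]|h].
    - exact: gsetP.
    - exact: gsetP.
    - by left; apply/asboolP.
    - by right; apply/asboolP.
    apply/ba_pU; [exact: gsetP|exact: gsetP|].
    by case: h => /asboolP h; [left|right].
  case: `[< ba_p A y >]; case: `[< ba_p B y >] => /=;
    by rewrite ?addrK ?subr0 ?addr0 ?add0r.
- rewrite !partial_linU; case h: (ba_s e y) => [z|]; last by rewrite linear0.
  by rewrite partial_linU; case: asboolP => // -[]; exact: ba_ps h.
- rewrite !partial_linU; case: asboolP => h; first by rewrite partial_linU.
  rewrite linear0; case hs: (ba_s e y) => [z|] //.
  by case: h; apply/ba_sr; exists z.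
- rewrite !partial_linU; case h: (ba_s' e y) => [z|]; last by rewrite linear0.
  rewrite partial_linU; case: asboolP => // -[]; apply/ba_sr; exists y.
  exact/ba_ss'.
- rewrite !partial_linU; case: asboolP => h; first by rewrite partial_linU.
  rewrite linear0; case hs: (ba_s' e y) => [z|] //.
  by case: h; apply: (@ba_ps _ _ e z); exact/ba_ss'.
- rewrite !partial_linU; case: asboolP => [/ba_sr[z h]|h].
    by rewrite h partial_linU; have /ba_ss' -> := h.
  case hs: (ba_s e y) => [z|]; last by rewrite linear0.
  by case: h; apply/ba_sr; exists z.
- rewrite partial_linU; case hs: (ba_s f y) => [z|]; last by rewrite linear0.
  by rewrite partial_linU (ba_s's0 ef hs).
- rewrite partial_linU.
  have -> : evalt basis_rho (foldr (@tadd _ _) tzero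
      [seq tmul (tgen (gen_s e)) (tgen (gen_sstar e)) | e <- fset_set (outs v)])
      << y >> = \sum_(e <- fset_set (outs v))
        partial_lin (ba_s e) (partial_lin (ba_s' e) << y >>).
    elim: (enum_fset _) => [|e l IH] /=; first by rewrite big_nil.
    by rewrite big_cons IH.
  have term e : partial_lin (ba_s e) (partial_lin (ba_s' e) << y >>) =
      if ba_s' e y is Some _ then << y >> else 0.
    rewrite partial_linU; case h: (ba_s' e y) => [z|]; last by rewrite linear0.
    by rewrite partial_linU; have /ba_ss' -> := h.
  rewrite (eq_bigr _ (fun e _ => term e)) {term}.
  have fin : finite_set (outs v) by case: rv.
  case: asboolP => h.
    have [e [z [ev ez]]] := ba_reg rv h.
    rewrite (bigD1_seq e) //=; last 2 first.
    + by rewrite in_fset_set // inE.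
    + exact: fset_uniq.
    rewrite ez big1 ?addr0 // => f /eqP fe; move/ba_ss': ez => ez.
    by rewrite (ba_s's0 fe ez).
  rewrite big_seq big1 // => e; rewrite in_fset_set // inE /outs /= => ev.
  case he: (ba_s' e y) => [z|] //; case: h; rewrite -ev.
  by apply: (@ba_ps _ _ e z); exact/ba_ss'.
Qed.

Definition basis_module : lmodule (@leavitt_rel K G) :=
  rep_module basis_rho_linear basis_rho_rel.

End BasisModule.

Section RangeModule.
Context (G : ultragraph) (x : upath G).

Record rbasis := RBasis {
  rb_path :> upath G;
  rb_rng : up_rng rb_path = up_rng x
}.

HB.instance Definition _ := gen_eqMixin rbasis.
HB.instance Definition _ := gen_choiceMixin rbasis.

Lemma rbasis_eq (y z : rbasis) : up_seq y = up_seq z -> y = z.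
Proof.
case: y z => [y hy] [z hz] /= e.
have yz : y = z by apply: upath_eq; rewrite ?hy.
by subst; rewrite (Prop_irrelevance hy hz).
Qed.

Definition rb_cons (e : edge G) (y : rbasis) (h : up_src_in y (rng e)) : rbasis :=
  @RBasis (up_cons h) (rb_rng y).

Definition rb_tail (y : rbasis) : rbasis := @RBasis (up_tail y) (rb_rng y).

Definition rb_p (A : set (vertex G)) (y : rbasis) : Prop := up_src_in y A.

Definition rb_s (e : edge G) (y : rbasis) : option rbasis :=
  if pselect (up_src_in y (rng e)) is left h then Some (rb_cons h) else None.

Definition rb_s' (e : edge G) (y : rbasis) : option rbasis :=
  if ohead (up_seq y) == Some e then Some (rb_tail y) else None.

Lemma rb_sP e y z : rb_s e y = Some z <->
  up_src_in y (rng e) /\ up_seq z = e :: up_seq y.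
Proof.
rewrite /rb_s; case: pselect => h; split=> //.
- by case=> <-.
- by case=> _ hz; congr Some; apply: rbasis_eq.
- by case.
Qed.

Lemma rb_s'P e y z : rb_s' e y = Some z <-> up_seq y = e :: up_seq z.
Proof.
rewrite /rb_s'; case: eqP => [h|h]; split=> //.
- case=> <-; rewrite /=; by case: (up_seq y) h => //= f l [->].
- move=> hy; congr Some; apply: rbasis_eq; by rewrite /= hy.
- by move=> hy; case: h; rewrite hy.
Qed.

Lemma up_seq_src (y z : rbasis) e :
  up_seq y = e :: up_seq z -> up_src_in z (rng e).
Proof.
case: y z => [[l A ok] /= rA] [[m B ok'] /= rB] lm; subst l.
case: ok => + _ le; rewrite /up_src_in /=; case: m ok' le => [|f m] _ /=.
  by rewrite rB -rA.
by move=> _ /andP[/asboolP].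
Qed.

Hypothesis hx : Yinf x.

Lemma ultraset_neq0 A : ultraset A -> A <> set0 :> set (vertex G).
Proof.
move=> [gA [[_ h _ _] _]] A0; apply: h; rewrite A0; split => //; exact: gen_set0.
Qed.

Lemma ultraset_setU (A B C : set (vertex G)) : ultraset A ->
  genset B -> genset C -> A `<=` B `|` C -> A `<=` B \/ A `<=` C.
Proof.
move=> [gA [filA maxA]] gB gC sA.
case: (pselect (A `&` B = set0)) => AB; [right|left].
  by move=> a Aa; case: (sA a Aa) => // Ba; exfalso; rewrite -[False]/(set0 a) -AB.
have gAB := gen_setI gA gB.
have fil : is_filter [set D | genset D /\ A `&` B `<=` D].
  split=> [D []//|[_]|D D' [gD sD] [gD' sD']|D D' [gD sD] gD' DD'].
  - by rewrite subset0.
  - split; first exact: gen_setI.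
    by move=> a aAB; split; [exact: sD|exact: sD'].
  - by split=> //; exact: subset_trans DD'.
have := maxA _ fil; move=> /(_ _) eqF.
have /eqF e : [set D | genset D /\ A `<=` D] `<=` [set D | genset D /\ A `&` B `<=` D].
  by move=> D [gD sD]; split=> //; apply: subset_trans sD; exact: subIsetl.
have : [set D | genset D /\ A `&` B `<=` D] (A `&` B) by split.
by rewrite e => -[_ h] a Aa; have [] := h a Aa.
Qed.

Fact rb_p0 y : ~ rb_p set0 y.
Proof.
case: y => [[[|e l] A ok] /= rA]; rewrite /rb_p /up_src_in //= subset0.
by rewrite rA; apply: ultraset_neq0; case: hx.
Qed.

Fact rb_pI A B y : rb_p (A `&` B) y <-> rb_p A y /\ rb_p B y.
Proof.
by rewrite /rb_p /up_src_in; case: (up_seq y) => //; rewrite subsetI.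
Qed.

Fact rb_pU A B y : genset A -> genset B ->
  rb_p (A `|` B) y <-> rb_p A y \/ rb_p B y.
Proof.
move=> gA gB; rewrite /rb_p /up_src_in; case: (up_seq y) => //.
rewrite rb_rng; split; first by apply: ultraset_setU => //; case: hx.
by case=> h; apply: (subset_trans h); [exact: subsetUl|exact: subsetUr].
Qed.

Fact rb_ps e y z : rb_s e y = Some z -> rb_p [set source e] z.
Proof. by move=> /rb_sP[_ hz]; rewrite /rb_p /up_src_in hz. Qed.

Fact rb_sr e y : (exists z, rb_s e y = Some z) <-> rb_p (rng e) y.
Proof.
split=> [[z /rb_sP[]]//|h]; exists (rb_cons h); exact/rb_sP.
Qed.

Fact rb_ss' e y z : rb_s' e y = Some z <-> rb_s e z = Some y.
Proof.
rewrite rb_s'P rb_sP; split=> [h|[]//]; split=> //; exact: up_seq_src h.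
Qed.

Fact rb_s's0 e f y z : e <> f -> rb_s f y = Some z -> rb_s' e z = None.
Proof.
by move=> ef /rb_sP[_ hz]; rewrite /rb_s' hz /=; case: eqP => // -[fe]; case: ef.
Qed.

Fact rb_reg v y : regular v -> rb_p [set v] y ->
  exists e z, source e = v /\ rb_s' e y = Some z.
Proof.
move=> [_ fin]; rewrite /rb_p /up_src_in; case l: (up_seq y) => [|e m].
  move=> sv; have [_ inf] := hx; exfalso; apply: inf.
  by apply: sub_finite_set fin => e /=; rewrite -(rb_rng y) => /sv.
by move=> ev; exists e, (rb_tail y); split=> //; apply/rb_s'P; rewrite l /= l.
Qed.

Definition range_action : basis_action G :=
  BasisAction rb_p0 rb_pI rb_pU rb_ps rb_sr rb_ss' rb_s's0 rb_reg.

End RangeModule.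

Definition V_range (K : fieldType) (G : ultragraph) (x : upath G) (hx : Yinf x) :
    lmodule (@leavitt_rel K G) :=
  basis_module K (range_action hx).

(* Irrationality of p is not needed to define V_{[p]}. *)
Section TailModule.
Context (G : ultragraph) (p : ipath G).

Record tbasis := TBasis {
  tb_path :> ipath G;
  tb_class : ip_class p tb_path
}.

HB.instance Definition _ := gen_eqMixin tbasis.
HB.instance Definition _ := gen_choiceMixin tbasis.

Lemma tbasis_eq (y z : tbasis) : y = z :> ipath G -> y = z.
Proof.
by case: y z => [y hy] [z hz] /= e; subst; rewrite (Prop_irrelevance hy hz).
Qed.

Definition tb_p (A : set (vertex G)) (q : tbasis) : Prop := A (ip_src q).

Definition tb_s (e : edge G) (q : tbasis) : option tbasis :=
  if pselect (rng e (ip_src q)) is left h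
  then Some (TBasis (ip_class_cons h (tb_class q))) else None.

Definition tb_s' (e : edge G) (q : tbasis) : option tbasis :=
  if (q : ipath G) 0%N == e then Some (TBasis (ip_class_tau 1 (tb_class q)))
  else None.

Lemma tb_sP e y z : tb_s e y = Some z <->
  rng e (ip_src y) /\ ((z : ipath G) 0%N = e /\ tau 1 z = y).
Proof.
rewrite /tb_s; case: pselect => h; split=> //.
- by case=> <-; split=> //; split=> //=; exact: ipath_eq.
- case=> _ [z0 ty]; congr Some; apply: tbasis_eq => /=.
  by apply: ipath_eq => -[|i] //=; rewrite -ty.
- by case.
Qed.

Lemma tb_s'P e y z : tb_s' e y = Some z <->
  (y : ipath G) 0%N = e /\ tau 1 y = z.
Proof.
rewrite /tb_s'; case: eqP => h; split=> //.
- by case=> <-.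
- by case=> _ yz; congr Some; apply: tbasis_eq.
- by case.
Qed.

Fact tb_p0 y : ~ tb_p set0 y. Proof. by []. Qed.

Fact tb_pI A B y : tb_p (A `&` B) y <-> tb_p A y /\ tb_p B y.
Proof. by []. Qed.

Fact tb_pU A B y : genset A -> genset B ->
  tb_p (A `|` B) y <-> tb_p A y \/ tb_p B y.
Proof. by []. Qed.

Fact tb_ps e y z : tb_s e y = Some z -> tb_p [set source e] z.
Proof. by move=> /tb_sP[_ [ze _]]; rewrite /tb_p /ip_src ze. Qed.

Fact tb_sr e y : (exists z, tb_s e y = Some z) <-> tb_p (rng e) y.
Proof.
split=> [[z /tb_sP[]]//|h]; exists (TBasis (ip_class_cons h (tb_class y))).
by apply/tb_sP; split=> //; split=> //=; exact: ipath_eq.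
Qed.

Fact tb_ss' e y z : tb_s' e y = Some z <-> tb_s e z = Some y.
Proof.
rewrite tb_s'P tb_sP; split=> [[h t]|[]//]; split=> //.
by rewrite -t /ip_src -h; exact: (ip_ok y 0).
Qed.

Fact tb_s's0 e f y z : e <> f -> tb_s f y = Some z -> tb_s' e z = None.
Proof.
by move=> ef /tb_sP[_ [zf _]]; rewrite /tb_s' zf; case: eqP => // fe; case: ef.
Qed.

Fact tb_reg v y : regular v -> tb_p [set v] y ->
  exists e z, source e = v /\ tb_s' e y = Some z.
Proof.
move=> _ yv; exists ((y : ipath G) 0%N), (TBasis (ip_class_tau 1 (tb_class y))).
by split=> //; apply/tb_s'P.
Qed.

Definition tail_action : basis_action G :=
  BasisAction tb_p0 tb_pI tb_pU tb_ps tb_sr tb_ss' tb_s's0 tb_reg.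

End TailModule.

Definition V_tail (K : fieldType) (G : ultragraph) (p : ipath G) :
    lmodule (@leavitt_rel K G) :=
  basis_module K (tail_action p).

(* int acting on a basis T, extended to K[t, t^-1] acting on {malg K[T]}. *)
Section ShiftScale.
Context (K : fieldType) (T : choiceType) (sh : int -> T -> T).

Definition shift_lin (i : int) : {malg K[T]} -> {malg K[T]} :=
  lext (fun y => << sh i y >>).

Definition shift_scale (g : {malg K[int]}) (x : {malg K[T]}) : {malg K[T]} :=
  lext (shift_lin^~ x) g.

HB.instance Definition _ i := GRing.isLinear.Build K {malg K[T]} {malg K[T]} *:%R
  (shift_lin i) (lext_is_linear _).

Lemma shift_linU i y : shift_lin i << y >> = << sh i y >>.
Proof. exact: lextU. Qed.

Lemma shift_scaleU g y :
  shift_scale g << y >> = lext (fun i => << sh i y >>) g.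
Proof. by apply: eq_lext => i; rewrite shift_linU. Qed.

Lemma shift_scaleDr g : {morph shift_scale g : x y / x + y}.
Proof.
move=> x y; rewrite /shift_scale -lextDf; apply: eq_lext => i.
by rewrite linearD.
Qed.

Lemma shift_scaleDl x : {morph shift_scale^~ x : g h / g + h}.
Proof. by move=> g h; rewrite /shift_scale linearD. Qed.

Hypothesis sh0 : forall y, sh 0 y = y.
Hypothesis shD : forall i j y, sh i (sh j y) = sh (i + j) y.

Lemma shift_lin0 x : shift_lin 0 x = x.
Proof.
by apply: (lext_ext (f := shift_lin 0) (g := idfun)) x => y; rewrite /= shift_linU sh0.
Qed.

Lemma shift_linD i j x : shift_lin i (shift_lin j x) = shift_lin (i + j) x.
Proof.
apply: (lext_ext (f := shift_lin i \o shift_lin j) (g := shift_lin (i + j))) x => y.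
by rewrite /= !shift_linU shD.
Qed.

Lemma shift_scale1 x : shift_scale << 0 >> x = x.
Proof. by rewrite /shift_scale lextU shift_lin0. Qed.

End ShiftScale.

(* K[t, t^-1], with basis the powers t^i = << i >>. *)
Section Laurent.
Context (K : fieldType).

Definition laurent := {malg K[int]}.
HB.instance Definition _ := GRing.Zmodule.on laurent.

Definition laurent_mul (g h : laurent) : laurent :=
  shift_scale (fun i j : int => i + j) g h.

Lemma laurent_mulE (g h : laurent) :
  laurent_mul g h = lext (fun i => lext (fun j => << i + j >>) h) g.
Proof. by []. Qed.

Lemma shift_scaleA (T : choiceType) (sh : int -> T -> T)
    (shD : forall i j y, sh i (sh j y) = sh (i + j) y) g h (x : {malg K[T]}) :
  shift_scale sh g (shift_scale sh h x) = shift_scale sh (laurent_mul g h) x.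
Proof.
rewrite /laurent_mul {1}/shift_scale {2}/shift_scale {2}/shift_scale.
rewrite (linear_lext (lext ((shift_lin (K := K) sh)^~ x))); apply: eq_lext => i /=.
rewrite /shift_scale (linear_lext (shift_lin sh i)).
rewrite /shift_lin (linear_lext (lext _)); apply: eq_lext => j /=.
by rewrite lextU; exact: (shift_linD shD).
Qed.

Fact laurent_mulA : associative laurent_mul.
Proof. by move=> f g h; rewrite {1 2}/laurent_mul shift_scaleA // => *; rewrite addrA. Qed.

Fact laurent_mulC : commutative laurent_mul.
Proof.
move=> g h; rewrite !laurent_mulE /lext.
under eq_bigr => i _ do rewrite scaler_sumr.
rewrite exchange_big /=; apply: eq_bigr => j _; rewrite scaler_sumr.
by apply: eq_bigr => i _; rewrite !scalerA mulrC addrC.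
Qed.

Fact laurent_mul1 : left_id (<< 0 >> : laurent) laurent_mul.
Proof. by move=> g; apply: shift_scale1 => i; rewrite add0r. Qed.

Fact laurent_mulDl : left_distributive laurent_mul +%R.
Proof. by move=> f g h; exact: shift_scaleDl. Qed.

Fact laurent_1_neq0 : (<< 0 >> : laurent) != 0.
Proof. by rewrite monalgU_eq0 oner_eq0. Qed.

HB.instance Definition _ := GRing.Zmodule_isComNzRing.Build laurent
  laurent_mulA laurent_mulC laurent_mul1 laurent_mulDl laurent_1_neq0.

End Laurent.

Section Irreducible.
Context (R : comNzRingType).

Definition is_unit (u : R) : Prop := exists v, u * v = 1.

Definition irreducible_elt (f : R) : Prop :=
  [/\ f <> 0, ~ is_unit f & forall a b, f = a * b -> is_unit a \/ is_unit b].

Definition associate (f g : R) : Prop := exists u, is_unit u /\ f = u * g.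

End Irreducible.

Section RationalModule.
Context (K : fieldType) (G : ultragraph) (c : ug_cycle G).

(* (q, k) stands for the triple (q, k, c^oo). *)
Definition in_Mc_basis (q : ipath G) (k : int) : Prop :=
  ip_class (cy_inf c) q /\
  exists m n : nat, k = m%:Z - n%:Z /\ tau m q = tau n (cy_inf c).

Record cbasis := CBasis {
  cb_path : ipath G;
  cb_deg : int;
  cb_ok : in_Mc_basis cb_path cb_deg
}.

HB.instance Definition _ := gen_eqMixin cbasis.
HB.instance Definition _ := gen_choiceMixin cbasis.

Lemma cbasis_eq (y z : cbasis) :
  cb_path y = cb_path z -> cb_deg y = cb_deg z -> y = z.
Proof.
case: y z => [p k h] [q l h'] /= pq kl; subst.
by rewrite (Prop_irrelevance h h').
Qed.

Fact cb_cons_ok e (y : cbasis) (h : rng e (ip_src (cb_path y))) :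
  in_Mc_basis (ip_cons h) (cb_deg y + 1).
Proof.
have [cl [m [n [k eq]]]] := cb_ok y; split; first exact: ip_class_cons.
exists m.+1, n; split; last by rewrite tau_cons.
by rewrite k -addn1 PoszD addrAC.
Qed.

Fact cb_tail_ok (y : cbasis) : in_Mc_basis (tau 1 (cb_path y)) (cb_deg y - 1).
Proof.
have [cl [m [n [k eq]]]] := cb_ok y; split; first exact: ip_class_tau.
exists m, n.+1; split; first by rewrite k -addn1 PoszD opprD addrA.
by rewrite tau_add addnC -tau_add eq tau_add addn1.
Qed.

Fact cb_shift_ok (i : int) (y : cbasis) :
  in_Mc_basis (cb_path y) (cb_deg y + i * (cy_len c)%:Z).
Proof.
have [cl [m [n [k eq]]]] := cb_ok y; split=> //; rewrite k.
have tcy a b : tau (a + b * cy_len c) (cy_inf c) = tau a (cy_inf c).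
  elim: b => [|b IH]; first by rewrite mul0n addn0.
  by rewrite mulSn addnCA addnC tau_cy.
case: i => j.
  exists (m + j * cy_len c)%N, n; split; first by rewrite PoszD PoszM addrAC.
  by rewrite -(tau_add (j * cy_len c) m) eq tau_add tcy.
exists m, (n + j.+1 * cy_len c)%N; split; last by rewrite tcy.
by rewrite NegzE PoszD PoszM opprD addrA mulNr.
Qed.

Definition cb_shift (i : int) (y : cbasis) : cbasis := CBasis (cb_shift_ok i y).

Definition cb_p (A : set (vertex G)) (y : cbasis) : Prop := A (ip_src (cb_path y)).

Definition cb_s (e : edge G) (y : cbasis) : option cbasis :=
  if pselect (rng e (ip_src (cb_path y))) is left h
  then Some (CBasis (cb_cons_ok h)) else None.

Definition cb_s' (e : edge G) (y : cbasis) : option cbasis :=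
  if cb_path y 0%N == e then Some (CBasis (cb_tail_ok y)) else None.

Lemma cb_sP e y z : cb_s e y = Some z <-> rng e (ip_src (cb_path y)) /\
  [/\ cb_path z 0%N = e, tau 1 (cb_path z) = cb_path y & cb_deg z = cb_deg y + 1].
Proof.
rewrite /cb_s; case: pselect => h; split=> //.
- by case=> <-; split=> //; split=> //=; exact: ipath_eq.
- case=> _ [z0 ty kz]; congr Some; apply: cbasis_eq => //=.
  by apply: ipath_eq => -[|i] //=; rewrite -ty.
- by case.
Qed.

Lemma cb_s'P e y z : cb_s' e y = Some z <->
  [/\ cb_path y 0%N = e, tau 1 (cb_path y) = cb_path z & cb_deg y = cb_deg z + 1].
Proof.
rewrite /cb_s'; case: eqP => h; split=> //.
- by case=> <-; split=> //=; rewrite subrK.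
- by case=> _ yz k; congr Some; apply: cbasis_eq => //=; rewrite k addrK.
- by case.
Qed.

Fact cb_p0 y : ~ cb_p set0 y. Proof. by []. Qed.

Fact cb_pI A B y : cb_p (A `&` B) y <-> cb_p A y /\ cb_p B y.
Proof. by []. Qed.

Fact cb_pU A B y : genset A -> genset B ->
  cb_p (A `|` B) y <-> cb_p A y \/ cb_p B y.
Proof. by []. Qed.

Fact cb_ps e y z : cb_s e y = Some z -> cb_p [set source e] z.
Proof. by move=> /cb_sP[_ [ze _ _]]; rewrite /cb_p /ip_src ze. Qed.

Fact cb_sr e y : (exists z, cb_s e y = Some z) <-> cb_p (rng e) y.
Proof.
split=> [[z /cb_sP[]]//|h]; exists (CBasis (cb_cons_ok h)).
by apply/cb_sP; split=> //; split=> //=; exact: ipath_eq.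
Qed.

Fact cb_ss' e y z : cb_s' e y = Some z <-> cb_s e z = Some y.
Proof.
rewrite cb_s'P cb_sP; split=> [[h t k]|[]//]; split=> //.
by rewrite -t /ip_src -h; exact: (ip_ok (cb_path y) 0).
Qed.

Fact cb_s's0 e f y z : e <> f -> cb_s f y = Some z -> cb_s' e z = None.
Proof.
by move=> ef /cb_sP[_ [zf _ _]]; rewrite /cb_s' zf; case: eqP => // fe; case: ef.
Qed.

Fact cb_reg v y : regular v -> cb_p [set v] y ->
  exists e z, source e = v /\ cb_s' e y = Some z.
Proof.
move=> _ yv; exists (cb_path y 0%N), (CBasis (cb_tail_ok y)).
by split=> //; apply/cb_s'P; split=> //=; rewrite subrK.
Qed.

Definition cycle_action : basis_action G :=
  BasisAction cb_p0 cb_pI cb_pU cb_ps cb_sr cb_ss' cb_s's0 cb_reg.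

Definition Mc : Type := {malg K[cbasis]}.
HB.instance Definition _ := GRing.Zmodule.on Mc.

Fact cb_shift0 y : cb_shift 0 y = y.
Proof. by apply: cbasis_eq => //=; rewrite mul0r addr0. Qed.

Fact cb_shiftD i j y : cb_shift i (cb_shift j y) = cb_shift (i + j) y.
Proof. by apply: cbasis_eq => //=; rewrite mulrDl addrAC addrA. Qed.

Definition Mc_scale (g : laurent K) (x : Mc) : Mc := shift_scale cb_shift g x.

Fact Mc_scaleA g h x : Mc_scale g (Mc_scale h x) = Mc_scale (g * h) x.
Proof. exact: (shift_scaleA cb_shiftD). Qed.

Fact Mc_scale1 : left_id 1 Mc_scale.
Proof. exact: shift_scale1 cb_shift0. Qed.

Fact Mc_scaleDr : right_distributive Mc_scale +%R.
Proof. by move=> g x y; exact: shift_scaleDr. Qed.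

Fact Mc_scaleDl x : {morph Mc_scale^~ x : g h / g + h}.
Proof. by move=> g h; exact: shift_scaleDl. Qed.

(* K[t, t^-1] being commutative, the right action is stored as a left one. *)
HB.instance Definition _ := GRing.Zmodule_isLmodule.Build (laurent K) Mc
  Mc_scaleA Mc_scale1 Mc_scaleDr Mc_scaleDl.

Definition Mc_module : lmodule (@leavitt_rel K G) := basis_module K cycle_action.

Definition Mc_act (a : leavitt K G) (x : Mc) : Mc :=
  lm_act (a : palg (@leavitt_rel K G)) (x : Mc_module).

Fact Mc_actDl x : {morph Mc_act^~ x : a b / a + b}.
Proof. exact: (@lm_actDl _ _ _ Mc_module x). Qed.

Fact Mc_actA (a b : leavitt K G) x : Mc_act (pmul a b) x = Mc_act a (Mc_act b x).
Proof. exact: (@lm_actA _ _ _ Mc_module a b x). Qed.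

Lemma partial_shift (f : cycle_action -> option cycle_action) i x :
  (forall y, f (cb_shift i y) = omap (cb_shift i) (f y)) ->
  partial_lin (K := K) f (shift_lin cb_shift i x) =
  shift_lin cb_shift i (partial_lin f x).
Proof.
move=> fs.
apply: (lext_ext (f := partial_lin f \o shift_lin cb_shift i)
                 (g := shift_lin cb_shift i \o partial_lin f)) x => y.
rewrite /= shift_linU /partial_lin !lextU fs; case: (f y) => [z|] /=.
  by rewrite shift_linU.
by rewrite linear0.
Qed.

Lemma evalt_shift t i x :
  evalt (@basis_rho K G cycle_action) t (shift_lin cb_shift i x) =
  shift_lin cb_shift i (evalt (@basis_rho K G cycle_action) t x).
Proof.
elim: t x => [[A|e|e]||t IH|s hs t ht|k t IH|s hs t ht] x /=.
- by apply: partial_shift => y; rewrite /= /cb_p /=; case: asboolP.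
- apply: partial_shift => y /=; rewrite /cb_s /=; case: pselect => h //=.
  by congr Some; apply: cbasis_eq => //=; rewrite addrAC.
- apply: partial_shift => y; rewrite /= /cb_s' /=; case: eqP => //= _.
  by congr Some; apply: cbasis_eq => //=; rewrite addrAC.
- by rewrite linear0.
- by rewrite IH linearN.
- by rewrite hs ht linearD.
- by rewrite IH linearZ.
- by rewrite ht hs.
Qed.

Fact Mc_act_is_linear a : linear (Mc_act a).
Proof.
move=> g x y; rewrite [LHS](lm_actDr (l := Mc_module)); congr (_ + _).
have L := ract_linear (@basis_rho_linear K G cycle_action) a.
pose m := GRing.isLinear.Build K {malg K[cbasis]} {malg K[cbasis]} *:%R _ L.
pose fa : {linear {malg K[cbasis]} -> {malg K[cbasis]}} := HB.pack (ract _ a) m.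
rewrite -[LHS]/(fa (lext ((shift_lin (K := K) cb_shift)^~ x) g)).
rewrite linear_lext.
rewrite -[RHS]/(lext ((shift_lin (K := K) cb_shift)^~ (Mc_act a x)) g).
by congr (lext _ g); apply/funext => i /=; exact: evalt_shift.
Qed.

HB.instance Definition _ a := GRing.isLinear.Build (laurent K) Mc Mc *:%R
  (Mc_act a) (Mc_act_is_linear a).

Definition laurent_mod (f : laurent K) : lmodType (laurent K) :=
  @quot (laurent K) (laurent K)^o [set f].

Section Vf.
Context (f : laurent K).
Notation V := (tensor Mc (laurent_mod f)).

Definition Vf_act (a : leavitt K G) (x : V) : V := tmap (Mc_act a) x.

Fact Vf_actDr a : {morph Vf_act a : x y / x + y}.
Proof. exact: tmap_additive. Qed.

Fact Vf_act0 a : Vf_act a 0 = 0.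
Proof. by apply: (addrI (Vf_act a 0)); rewrite -Vf_actDr !addr0. Qed.

Fact Vf_actN a : {morph Vf_act a : x / - x}.
Proof.
move=> x; apply: (addrI (Vf_act a x)).
by rewrite -Vf_actDr !subrr Vf_act0.
Qed.

Fact Vf_actDl x : {morph Vf_act^~ x : a b / a + b}.
Proof.
move=> a b; move: x; apply: tensor_ind => [m n||x y hx hy|x hx].
- by rewrite /Vf_act !tmap_pure -tpureDl -Mc_actDl.
- by rewrite !Vf_act0 addr0.
- by rewrite 3!Vf_actDr hx hy addrACA.
- by rewrite 3!Vf_actN hx opprD.
Qed.

Fact Vf_actA a b x : Vf_act (pmul a b) x = Vf_act a (Vf_act b x).
Proof.
move: x; apply: tensor_ind => [m n||x y hx hy|x hx].
- by rewrite /Vf_act !tmap_pure /= Mc_actA.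
- by rewrite !Vf_act0.
- by rewrite 3!Vf_actDr hx hy.
- by rewrite 3!Vf_actN hx.
Qed.

Definition V_rational : lmodule (@leavitt_rel K G) :=
  LModule Vf_actDr Vf_actDl Vf_actA.

End Vf.
End RationalModule.

Section Family.
Context (K : fieldType) (G : ultragraph) (cyc : cycle_choice G).

Inductive family_index : Type :=
| Index_range x of @Yinf G x
| Index_irrational p of @irrational G p
| Index_rational (p : rpath G) (f : laurent K) of irreducible_elt f.

Definition lpa_family (i : family_index) : lmodule (@leavitt_rel K G) :=
  match i with
  | @Index_range x hx => V_range K hx
  | @Index_irrational p _ => V_tail K p
  | @Index_rational p f _ => V_rational (cyc p) f
  end.

Definition same_member (i j : family_index) : Prop :=
  match i, j with
  | @Index_range x _, @Index_range y _ => up_rng x = up_rng y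
  | @Index_irrational p _, @Index_irrational q _ => ip_class p = ip_class q
  | @Index_rational p f _, @Index_rational q g _ =>
      ip_class p = ip_class q /\ associate f g
  | _, _ => False
  end.

End Family.

(* Main.v *)
(* For an infinite path q and a module M, let M(q) be the space of the vectors u
   with s_l s_l^* u = u for every initial segment l of q, a space defined by the
   module structure alone. If q and r have a common tail, then removing a segment
   of q and prepending one of r maps M(q) bijectively onto M(r). Long initial
   segments separate distinct paths, so the sum of the M(q) is direct and a
   submodule containing a sum of such vectors contains its components, up to
   removal of a common segment. V_[p] and V^f_[p] are spanned by the M(q) with
   q ~ p; such an M is thus simple as soon as the algebra acts transitively on the
   nonzero vectors of one M(q). For V_[p] the space M(p) is the line K p. For
   V^f_[p] the space M(c^oo) is K[t, t^-1]/(f), because c has least length, and the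
   paths c, c^* act there by t, t^-1; it is a field by the Bezout identity. All M(q)
   vanish on V_r(x), whose vectors killed by every s_e^* form the line K r(x).
   These invariants separate the family, except for V^f and V^g over one class,
   where f(s_c) annihilates M(c^oo) in the first module but is injective on it in
   the second when f and g are not associate. *)
Require Import Defs.
From HB Require Import structures.
From mathcomp Require Import all_boot all_order all_algebra finmap.
From mathcomp Require Import boolp classical_sets.
From mathcomp Require Import monalg.

Set Implicit Arguments.
Unset Strict Implicit.
Unset Printing Implicit Defensive.

Import GRing.Theory.
Local Open Scope classical_set_scope.
Local Open Scope ring_scope.

(** * Elementary facts on modules, submodules and isomorphisms *)

Section ModuleTheory.
Context {K : nzRingType} {X : Type} {rel : algterm K X -> algterm K X -> Prop}.
Implicit Types M N : lmodule rel.

Lemma lm_act0 M a : lm_act a (0 : M) = 0.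
Proof. by apply: (addrI (lm_act a 0)); rewrite -lm_actDr !addr0. Qed.

Lemma lm_actN M a : {morph @lm_act _ _ _ M a : u / - u}.
Proof.
by move=> u; apply: (addrI (lm_act a u)); rewrite -lm_actDr !subrr lm_act0.
Qed.

Lemma submoduleD M (S : set M) u v : submodule S -> S u -> S v -> S (u + v).
Proof.
case=> S0 SB _ Su Sv; rewrite -[v]opprK; apply: (SB) => //.
by rewrite -[- v]add0r; exact: SB.
Qed.

Lemma hom0 M N (phi : M -> N) : {morph phi : u v / u + v} -> phi 0 = 0.
Proof. by move=> D; apply: (addrI (phi 0)); rewrite -D !addr0. Qed.

Lemma isomorphic_sym M N : isomorphic M N -> isomorphic N M.
Proof.
case=> phi [D L [psi psiK phiK]]; exists psi; split; last by exists phi.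
- by move=> u v; apply: (can_inj psiK); rewrite D !phiK.
- by move=> a u; apply: (can_inj psiK); rewrite L !phiK.
Qed.

End ModuleTheory.

(** * Germs of a module along infinite paths *)

Section Germs.
Context {K : fieldType} {G : ultragraph}.
Notation mod := (lmodule (@leavitt_rel K G)).
Implicit Types (M : mod) (e f : edge G) (q r : ipath G).

Definition lp (A : gvertex G) : leavitt K G := ppi (@leavitt_rel K G) (tgen (gen_p A)).
Definition ls e : leavitt K G := ppi (@leavitt_rel K G) (tgen (gen_s e)).
Definition ls' e : leavitt K G := ppi (@leavitt_rel K G) (tgen (gen_sstar e)).

Definition acts M (a : leavitt K G) : M -> M := lm_act (a : palg (@leavitt_rel K G)).

Lemma act_rel M s t :
  leavitt_rel s t -> acts (ppi (@leavitt_rel K G) s) =1 acts (M := M) (ppi _ t).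
Proof. by move=> /pc_rel /ppiP st u; rewrite /acts st. Qed.

Lemma act_mul M s t u :
  acts (M := M) (ppi _ (tmul s t)) u = acts (ppi _ s) (acts (ppi _ t) u).
Proof. by rewrite -[ppi _ (tmul s t)]pmulE /acts lm_actA. Qed.

Lemma act_s's0 M e f (u : M) : e <> f -> acts (ls' e) (acts (ls f) u) = 0.
Proof.
move=> ef; rewrite -act_mul (act_rel (lr_s's0 _ ef)).
by apply: (addrI (acts (ppi _ tzero) u)); rewrite /acts -lm_actDl !addr0.
Qed.

Lemma act_s's M e (u : M) : acts (ls' e) (acts (ls e) u) = acts (lp (gvr e)) u.
Proof. by rewrite -act_mul (act_rel (lr_s's _ e)). Qed.

(** As [source f] lies in [rng e], the projection at [rng e] fixes the one at [source f], which in
    turn fixes [s_f]. *)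
Lemma act_ps M e f (u : M) : rng e (source f) ->
  acts (lp (gvr e)) (acts (ls f) u) = acts (ls f) u.
Proof.
move=> ef; have ps : acts (lp (gv1 (source f))) (acts (ls f) u) = acts (ls f) u.
  by rewrite -act_mul (act_rel (lr_ps _ f)).
rewrite -[in LHS]ps -act_mul (act_rel (lr_pI _ _ _)) -[RHS]ps.
congr (acts (lp _) _).
have : rng e `&` [set source f] = [set source f].
  by apply/seteqP; split=> [v []//|v ->].
rewrite /gvI /gv1; move: (gen_setI _ _) => /= g eqA.
by move: g; rewrite eqA => g; rewrite (Prop_irrelevance g (gen_vertex _)).
Qed.

(** For the initial segment [l] of [q] of length [n], this is the action of [s_l^*]; [unpeel] is
    that of [s_l]. *)
Fixpoint peel M q n (u : M) : M :=
  if n is m.+1 then acts (ls' (q m)) (peel q m u) else u.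

Fixpoint unpeel M q n (u : M) : M :=
  if n is m.+1 then unpeel q m (acts (ls (q m)) u) else u.

(* In the modules of the family these are the vectors supported on the single
   infinite path [q]. *)
Definition germ M q (u : M) : Prop :=
  forall n, acts (ls (q n)) (peel q n.+1 u) = peel q n u.

Lemma peel_add M q m n (u : M) : peel q (m + n) u = peel (tau m q) n (peel q m u).
Proof. by elim: n => [|n IH]; rewrite ?addn0 // addnS /= IH. Qed.

Lemma peel0 M q n : peel q n (0 : M) = 0.
Proof. by elim: n => //= n ->; exact: lm_act0. Qed.

Lemma peelD M q n : {morph @peel M q n : u v / u + v}.
Proof. by move=> u v; elim: n => //= n ->; exact: lm_actDr. Qed.

Lemma unpeel0 M q n : unpeel q n (0 : M) = 0.
Proof. by elim: n => //= n IH; rewrite /acts lm_act0. Qed.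

Lemma germD M q (u v : M) : germ q u -> germ q v -> germ q (u + v).
Proof. by move=> gu gv n; rewrite !peelD /acts lm_actDr -!/(acts _ _) gu gv. Qed.

Lemma germN M q (u : M) : germ q u -> germ q (- u).
Proof.
have pN n : peel q n (- u) = - peel q n u by elim: n => //= n ->; exact: lm_actN.
by move=> gu n; rewrite !pN /acts lm_actN -!/(acts _ _) gu.
Qed.

Lemma germ_peel M q n (u : M) : germ q u -> germ (tau n q) (peel q n u).
Proof. by move=> gu m; rewrite -!peel_add addnS; exact: gu. Qed.

Lemma peelK M q n (u : M) : germ q u -> unpeel q n (peel q n u) = u.
Proof. by move=> gu; elim: n => // n IH; rewrite /= [acts (ls _) _]gu. Qed.

(** The germ condition puts [u] in the image of [s_{q(n+1)}], so [u] is fixed by the projection at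
    the range of [q n], which is [s_{q n}^* s_{q n}]. *)
Lemma germ_s M q n (u : M) : germ (tau n.+1 q) u ->
  acts (ls' (q n)) (acts (ls (q n)) u) = u.
Proof.
move=> gu; rewrite act_s's -[u in LHS](gu 0%N) act_ps; first exact: (gu 0%N).
by rewrite /= addn0; exact: ip_ok.
Qed.

Lemma unpeelK M q n (u : M) : germ (tau n q) u ->
  germ q (unpeel q n u) /\ peel q n (unpeel q n u) = u.
Proof.
elim: n u => [|n IH] u gu /=.
  split=> //; suff -> : q = tau 0 q by [].
  exact: ipath_eq.
have K1 := germ_s gu.
have [|g p] := IH (acts (ls (q n)) u); last by rewrite p K1.
(* The first peeling step undoes the prepended edge, so beyond index 0 the germ condition is that of
   [u]; index 0 is [K1]. *)
have E k : peel (tau n q) k.+1 (acts (ls (q n)) u) = peel (tau n.+1 q) k u.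
  by rewrite -addn1 addnC peel_add /= addn0 K1 tau_add addn1.
case=> [|m]; first by rewrite /= addn0 K1.
by rewrite !E -[RHS]gu /= addSnnS.
Qed.

Definition transport M q m r n (u : M) : M := unpeel r n (peel q m u).

Lemma germ_transport M q m r n (u : M) :
  tau m q = tau n r -> germ q u -> germ r (transport q m r n u).
Proof. by move=> h gu; apply: (unpeelK _).1; rewrite -h; exact: germ_peel. Qed.

Lemma transportK M q m r n (u : M) : tau m q = tau n r -> germ q u ->
  transport r n q m (transport q m r n u) = u.
Proof.
move=> h gu; rewrite /transport (unpeelK _).2 ?peelK // -h; exact: germ_peel.
Qed.

Lemma transport0 M q m r n : transport q m r n (0 : M) = 0.
Proof. by rewrite /transport peel0 unpeel0. Qed.

Lemma peel_submodule M q n (S : set M) u : submodule S -> S u -> S (peel q n u).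
Proof. by case=> _ _ h Su; elim: n => //= n; exact: h. Qed.

Lemma unpeel_submodule M q n (S : set M) u : submodule S -> S u -> S (unpeel q n u).
Proof. by case=> _ _ h; elim: n u => //= n IH u Su; apply: IH; exact: h. Qed.

Lemma transport_submodule M q m r n (S : set M) u :
  submodule S -> S u -> S (transport q m r n u).
Proof. by move=> hS Su; apply: unpeel_submodule => //; exact: peel_submodule. Qed.

Lemma peel_hom M M' (phi : M -> M') q n u :
  (forall a u, phi (lm_act a u) = lm_act a (phi u)) ->
  phi (peel q n u) = peel q n (phi u).
Proof. by move=> h; elim: n => //= n <-; exact: h. Qed.

Lemma germ_hom M M' (phi : M -> M') q u :
  (forall a u, phi (lm_act a u) = lm_act a (phi u)) ->
  germ q u -> germ q (phi u).
Proof.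
by move=> h gu n; rewrite -!(peel_hom _ _ _ h) -[in RHS](gu n); exact/esym/h.
Qed.

(** At the first index [j] where the paths differ, the peeled vector lies in the image of [s_{q j}],
    which [s_{r j}^*] kills. *)
Lemma germ_separate M q r (u : M) : germ q u -> q <> r ->
  exists n, forall m, (n <= m)%N -> peel r m u = 0.
Proof.
move=> gu qr; have [i qi] : exists i, q i <> r i.
  by apply/not_existsP => h; apply: qr; apply: ipath_eq => i; apply/notP/h.
pose P i := `[< q i <> r i >]; have exP : exists i, P i by exists i; apply/asboolP.
case: (ex_minnP exP) => j /asboolP qj jmin.
exists j.+1 => m jm.
have same k : (k <= j)%N -> peel r k u = peel q k u.
  elim: k => //= k IH kj; rewrite IH 1?ltnW //.
  suff -> : r k = q k by [].
  apply/notP => h; have := jmin k; rewrite leqNgt kj => /(_ _)/notF; apply.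
  by apply/asboolP => /esym.
rewrite -(subnKC jm) peel_add /= same // -(gu j) act_s's0 ?peel0 //.
by move/esym.
Qed.

(** [B] constrains only the component along [r] itself; the others need only run along paths sharing
    a tail with [r]. *)
Definition germ_sum M r (B : set M) (u : M) : Prop :=
  exists (s : seq (ipath G)) (F : ipath G -> M),
    [/\ uniq s,
        forall q, q \in s -> [/\ ipeq q r, germ q (F q) & q = r -> B (F q)]
      & u = \sum_(q <- s) F q].

(* The sum is automatically direct, by [germ_separate]. *)
Definition concentrated M r (B : set M) : Prop := forall u, germ_sum r B u.

Lemma peel_sum M q n (s : seq (ipath G)) (F : ipath G -> M) :
  peel q n (\sum_(r <- s) F r) = \sum_(r <- s) peel q n (F r).
Proof. by apply: big_morph; [exact: peelD|exact: peel0]. Qed.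

Lemma peel_separate M q (s : seq (ipath G)) (F : ipath G -> M) :
  (forall r, r \in s -> germ r (F r)) -> q \notin s ->
  exists n, peel q n (\sum_(r <- s) F r) = 0.
Proof.
move=> gF qs.
suff [n hn] : exists n, forall r, r \in s -> peel q n (F r) = 0.
  by exists n; rewrite peel_sum big_seq big1.
(* Vanishing for all larger lengths lets the finitely many bounds be merged by a maximum. *)
suff [n hn] : exists n, forall m r, (n <= m)%N -> r \in s -> peel q m (F r) = 0.
  by exists n => r; exact: hn.
elim: s gF qs => [|r s IH] gF; first by exists 0%N.
rewrite inE negb_or => /andP[/eqP qr qs].
have [|n hn] := IH _ qs; first by move=> r' r's; apply: gF; rewrite inE r's orbT.
have [||k hk] := @germ_separate M r q (F r); first by apply: gF; rewrite mem_head.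
  by move/esym.
exists (maxn n k) => m r'; rewrite geq_max => /andP[nm km].
by rewrite inE => /predU1P[->|]; [exact: hk|exact: hn].
Qed.

(** A germ along [q] equals the component along [q] of any decomposition: both peel to the same
    vector far enough along [q], and peeling is injective on germs. If [q] does not occur, that
    vector is zero. *)
Lemma concentrated_germ M r B q (u : M) : B 0 -> concentrated r B -> germ q u ->
  (q = r -> B u) /\ (u <> 0 -> ipeq q r).
Proof.
move=> B0 conc gu; have [s [F [us hF uE]]] := conc u.
have gF r' : r' \in s -> germ r' (F r') by case/hF.
have [qs|qs] := boolP (q \in s); last first.
  have [n] := peel_separate gF qs; rewrite -uE => hn.
  suff -> : u = 0 by split.
  by rewrite -(peelK n gu) hn unpeel0.
have [n hn] : exists n, peel q n (\sum_(r' <- rem q s) F r') = 0.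
  apply: peel_separate => [r' /mem_rem/gF //|].
  by rewrite (mem_rem_uniq _ us) inE eqxx.
have uF : u = F q.
  rewrite -(peelK n gu) -(peelK n (gF _ qs)) uE (big_rem q) //= peelD hn addr0.
  by [].
by have [h1 _ h3] := hF q qs; split; rewrite uF.
Qed.

Lemma germ_sum0 M r (B : set M) : germ_sum r B 0.
Proof. by exists [::], (fun=> 0); split=> //; rewrite big_nil. Qed.

Lemma germ_sum_germ M r (B : set M) q u :
  ipeq q r -> germ q u -> (q = r -> B u) -> germ_sum r B u.
Proof.
move=> qr gu Bu; exists [:: q], (fun=> u); split=> //; last by rewrite big_seq1.
by move=> q'; rewrite inE => /eqP->.
Qed.

Lemma germ_sumD M r (B : set M) u v :
  B 0 -> (forall x y, B x -> B y -> B (x + y)) ->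
  germ_sum r B u -> germ_sum r B v -> germ_sum r B (u + v).
Proof.
move=> B0 BD [s [F [us hF ->]]] [s' [F' [us' hF' ->]]].
pose ext (l : seq (ipath G)) (H : ipath G -> M) q := if q \in l then H q else 0.
(* Both families are extended by zero to the union of the two index lists. *)
have extE (l l' : seq (ipath G)) H : uniq l -> uniq l' -> {subset l <= l'} ->
    \sum_(q <- l) H q = \sum_(q <- l') ext l H q.
  move=> ul ul' sl; rewrite /ext -big_mkcond -big_filter; apply: perm_big.
  apply: uniq_perm; rewrite ?filter_uniq // => q; rewrite mem_filter.
  by case: (boolP (q \in l)) => // /sl ->.
exists (undup (s ++ s')), (fun q => ext s F q + ext s' F' q); split.
- exact: undup_uniq.
- move=> q; rewrite mem_undup mem_cat => /orP qs; rewrite /ext.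
  case: (boolP (q \in s)) => [/hF[h1 h2 h3]|ns];
    case: (boolP (q \in s')) => [/hF'[k1 k2 k3]|ns'].
  + by split=> // [|qr]; [exact: germD|apply: BD; [exact: h3|exact: k3]].
  + by rewrite addr0.
  + by rewrite add0r.
  + by case: qs => qs; [rewrite qs in ns|rewrite qs in ns'].
- rewrite big_split /= (extE _ (undup (s ++ s'))) ?(extE s' (undup (s ++ s')))
    ?undup_uniq //.
  + by move=> q qs; rewrite mem_undup mem_cat qs orbT.
  + by move=> q qs; rewrite mem_undup mem_cat qs.
Qed.

Lemma germ_sumN M r (B : set M) u :
  (forall x, B x -> B (- x)) -> germ_sum r B u -> germ_sum r B (- u).
Proof.
move=> BN [s [F [us hF ->]]]; exists s, (fun q => - F q); split=> //; last first.
  by rewrite sumrN.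
by move=> q /hF[h1 h2 h3]; split=> // [|/h3/BN//]; exact: germN.
Qed.

(** A nonzero submodule contains a nonzero germ along [r], hence by transitivity all germs along
    [r]; transport gives all germs along equivalent paths, and these span by concentration. *)
Lemma simple_concentrated M r (B : set M) :
  concentrated r B -> (exists u : M, germ r u /\ u <> 0) ->
  (forall u v : M, germ r u -> u <> 0 -> germ r v -> exists a, v = acts a u) ->
  simple M.
Proof.
move=> conc [u0 [gu0 u00]] trans; split.
  have [a ua] := trans _ _ gu0 u00 gu0.
  by exists a, u0; rewrite -[lm_act _ _]/(acts a u0) -ua.
move=> N hN; case: (pselect (N = [set 0])) => N0; [by left|right].
have [u Nu u0'] : exists2 u, N u & u <> 0.
  apply: contrapT => h; apply: N0; apply/seteqP; split=> [u Nu|_ ->].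
    by apply: contrapT => u0'; apply: h; exists u.
  by case: hN.
have [w [Nw gw w0]] : exists w, [/\ N w, germ r w & w <> 0].
  have [s [F [us hF uE]]] := conc u.
  have [q qs Fq0] : exists2 q, q \in s & F q <> 0.
    apply: contrapT => h; apply: u0'; rewrite uE big_seq big1 // => q qs.
    by apply: contrapT => Fq; apply: h; exists q.
  have gF r' : r' \in s -> germ r' (F r') by case/hF.
  (* Far enough along [q] every component except [F q] dies, so peeling isolates a nonzero germ
     inside [N]. *)
  have [n hn] : exists n, peel q n (\sum_(r' <- rem q s) F r') = 0.
    apply: peel_separate => [r' /mem_rem/gF //|].
    by rewrite (mem_rem_uniq _ us) inE eqxx.
  have pu : peel q n u = peel q n (F q) by rewrite uE (big_rem q) //= peelD hn addr0.
  have gp := germ_peel n (gF _ qs).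
  have [m [k mk]] : ipeq (tau n q) r.
    have [[m [k mk]] _ _] := hF q qs; exists m, (k + n)%N.
    by rewrite -tau_add -mk !tau_add addnC.
  exists (transport (tau n q) m r k (peel q n u)); split.
  - by apply: transport_submodule => //; exact: peel_submodule.
  - by apply: germ_transport => //; rewrite pu.
  - move=> t0; have := transportK mk gp; rewrite -pu t0 transport0 pu => p0.
    by apply: Fq0; rewrite -(peelK n (gF _ qs)) -p0 unpeel0.
have Ngerm q v : ipeq q r -> germ q v -> N v.
  move=> [m [k mk]] gv; rewrite -(transportK mk gv).
  apply: transport_submodule => //.
  have [a ->] := trans _ _ gw w0 (germ_transport mk gv).
  by case: hN => _ _; exact.
apply/seteqP; split=> // v _; have [s [F [us hF ->]]] := conc v.
rewrite big_seq; elim/big_ind: _ => [|x y|q /hF[? ? _]]; last exact: (Ngerm q).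
- by case: hN.
- exact: submoduleD.
Qed.

(** An isomorphism keeps a nonzero germ along [r], whereas nonzero germs of [M'] live only along
    paths equivalent to [r']. *)
Lemma concentrated_not_isomorphic M M' r r' (B : set M') :
  concentrated r' B -> B 0 -> (exists u : M, germ r u /\ u <> 0) -> ~ ipeq r r' ->
  ~ isomorphic M M'.
Proof.
move=> conc B0 [u [gu u0]] rr' [phi [D L /bij_inj inj]].
have [_ h] := concentrated_germ B0 conc (germ_hom L gu).
by apply/rr'/h => pu0; apply/u0/inj; rewrite (hom0 D).
Qed.

End Germs.

Arguments acts {K G M} a u : simpl never.

(** * Basis modules *)

Lemma malgUZ (R : nzRingType) (T : choiceType) (c : R) (y : T) :
  << c *g y >> = c *: << y >> :> {malg R[T]}.
Proof. by apply/malgP => k; rewrite mcoeffZ !mcoeffU mulrnAr mulr1. Qed.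

Lemma malgU0 (R : nzRingType) (T : choiceType) (y : T) :
  << 0 *g y >> = 0 :> {malg R[T]}.
Proof. by apply/eqP; rewrite monalgU_eq0. Qed.

Lemma malgU1_neq0 (R : nzRingType) (T : choiceType) (y : T) :
  (<< y >> == 0 :> {malg R[T]}) = false.
Proof. by rewrite monalgU_eq0 oner_eq0. Qed.

Section BasisModules.
Context {K : fieldType} {G : ultragraph} (T : basis_action G).
Notation BM := (basis_module K T).
Implicit Types (e : edge G) (x : BM) (y z : T).

Lemma act_s'E e x : acts (ls' e) x = partial_lin (ba_s' e) x.
Proof. exact: (ractE (@basis_rho_linear K G T) (@basis_rho_rel K G T)). Qed.

Lemma act_sE e x : acts (ls e) x = partial_lin (ba_s e) x.
Proof. exact: (ractE (@basis_rho_linear K G T) (@basis_rho_rel K G T)). Qed.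

Lemma act_pE A x : acts (lp A) x =
  partial_lin (fun y => if `[< ba_p A y >] then Some y else None) x.
Proof. exact: (ractE (@basis_rho_linear K G T) (@basis_rho_rel K G T)). Qed.

Lemma act_scale (k : K) (a : leavitt K G) x :
  acts (k *: a) x = k *: acts a x :> {malg K[T]}.
Proof.
move: a; apply: (palgW (rel := @leavitt_rel K G)) => t.
rewrite -[k *: _]/(pscale k (ppi (@leavitt_rel K G) t)) pscaleE.
by rewrite /acts /= !(ractE (@basis_rho_linear K G T) (@basis_rho_rel K G T)).
Qed.

Lemma partial_linUc (f : T -> option T) c y :
  partial_lin f << c *g y >> = if f y is Some z then << c *g z >> else 0 :> {malg K[T]}.
Proof.
rewrite malgUZ linearZ /= partial_linU; case: (f y) => [z|].
  by rewrite -malgUZ.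
by rewrite scaler0.
Qed.

(** [ba_s e] and [ba_s' e] are mutually inverse partial injections, so only the image of [z] under
    [s_e] can contribute to the coefficient of [z]. *)
Lemma coeff_act_s' e (x : {malg K[T]}) z :
  (acts (ls' e) (x : BM) : {malg K[T]})@_z = if ba_s e z is Some y then x@_y else 0.
Proof.
rewrite act_s'E; move: x; apply: malg_ind => [|x y hx hy|c x hx|y].
- by rewrite linear0 !mcoeff0; case: (ba_s e z) => // w; rewrite mcoeff0.
- rewrite linearD mcoeffD hx hy; case: (ba_s e z) => [w|]; last by rewrite addr0.
  by rewrite mcoeffD.
- rewrite linearZ mcoeffZ hx; case: (ba_s e z) => [w|]; last by rewrite mulr0.
  by rewrite mcoeffZ.
- rewrite partial_linU; case hy: (ba_s' e y) => [w|]; case hz: (ba_s e z) => [v|];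
    rewrite ?mcoeffU ?mcoeff0.
  + congr (_%:R); congr nat_of_bool; apply/eqP/eqP => [wz|yv].
      by move: hy; rewrite wz => /ba_ss'; rewrite hz => -[].
    by move: hz; rewrite -yv => /ba_ss'; rewrite hy => -[].
  + case: eqP => // wz; move: hy; rewrite wz => /ba_ss'; by rewrite hz.
  + case: eqP => // yv; move: hz; rewrite -yv => /ba_ss'; by rewrite hy.
  + by [].
Qed.

(** Serves both V_[p] and M_c: [pth y] is the path labelling [y], and removing its first edge yields
    another basis element, from which prepending that edge recovers [y]. *)
Lemma germ_basis (pth : T -> ipath G) :
  (forall y, exists2 z, ba_s' (pth y 0%N) y = Some z & pth z = tau 1 (pth y)) ->
  forall (c : K) y, germ (pth y) (<< c *g y >> : BM).
Proof.
move=> H c y.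
have pE n : exists2 z, peel (pth y) n (<< c *g y >> : BM) = << c *g z >>
    & pth z = tau n (pth y).
  elim: n => [|n [z zE zn]]; first by exists y => //; exact: ipath_eq.
  have [w sw pw] := H z; exists w; last by rewrite pw zn tau_add addn1.
  rewrite /= zE.
  rewrite act_s'E partial_linUc.
  have -> : pth y n = pth z 0%N by rewrite zn /= addn0.
  by rewrite sw.
move=> n; have [z zE zn] := pE n; have [w sw pw] := H z; rewrite /= zE.
have -> : pth y n = pth z 0%N by rewrite zn /= addn0.
rewrite act_s'E partial_linUc sw act_sE partial_linUc.
by have /ba_ss' -> := sw.
Qed.

End BasisModules.

(** * The modules of ultrapaths ending in a fixed ultraset *)

Section Range.
Context {K : fieldType} {G : ultragraph}.

Section OneRange.
Context (x : upath G) (hx : Yinf x).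
Notation V := (V_range K hx).
Notation rb := (rbasis x).

Definition shorter n (u : V) : Prop :=
  forall y : rb, (n <= size (up_seq y))%N -> (u : {malg K[rb]})@_y = 0.

Lemma shorter_s' n e u : shorter n.+1 u -> shorter n (acts (ls' e) u).
Proof.
move=> su y ny; rewrite (coeff_act_s' (T := range_action hx)) /=.
by case h: (rb_s e y) => [z|] //; apply: su; have /rb_sP[_ ->] := h.
Qed.

Lemma shorter0 u : shorter 0 u -> u = 0.
Proof. by move=> su; apply/malgP => y; rewrite mcoeff0; exact: su. Qed.

Lemma shorter_ex u : exists n, shorter n u.
Proof.
exists (\max_(y <- msupp (u : {malg K[rb]})) size (up_seq y)).+1 => y hy.
apply/eqP; rewrite -[_ == 0]negbK mcoeff_neq0; apply/negP => yu.
move: hy; rewrite ltnNge => /negP; apply.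
exact: (@leq_bigmax_seq _ _ xpredT (fun y : rb => size (up_seq y))).
Qed.

(** Each [s_e^*] shortens ultrapaths, so a long enough peeling kills [u], while a germ is recovered
    from its peelings. *)
Lemma range_no_germ q u : @germ K G V q u -> u = 0.
Proof.
move=> gu; have [n su] := shorter_ex u; rewrite -(peelK n gu).
suff -> : peel q n u = 0 by rewrite unpeel0.
suff h k : (k <= n)%N -> shorter (n - k) (peel q k u).
  by apply: shorter0; rewrite -(subnn n); exact: h.
elim: k => [|k IH] kn; first by rewrite subn0.
by apply: shorter_s'; rewrite -subSn // subSS; apply: IH; rewrite ltnW.
Qed.

Lemma range_base_ok : is_upath [::] (up_rng x).
Proof. by split=> //; case: hx => -[]. Qed.

Definition range_base : rb := @RBasis _ x (UPath range_base_ok) erefl.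

(** The coefficient of an ultrapath starting with the edge [e] is a coefficient of [s_e^* u], so
    only the basis vector of length zero survives. *)
Lemma killed_range_base (u : V) : (forall e, acts (ls' e) u = 0) ->
  exists k, u = << k *g range_base >>.
Proof.
move=> ku; exists ((u : {malg K[rb]})@_range_base); apply/malgP => y; rewrite mcoeffU.
case hy: (up_seq y) => [|e l].
  have -> : y = range_base by apply: rbasis_eq; rewrite hy.
  by rewrite eqxx mulr1n.
case: eqP => [by0|_]; first by move: hy; rewrite -by0.
rewrite mulr0n.
have /rb_ss' sy : rb_s' e y = Some (rb_tail y) by apply/rb_s'P; rewrite hy /= hy.
have := coeff_act_s' (T := range_action hx) e u (rb_tail y).
by rewrite /= sy => <-; rewrite ku mcoeff0.
Qed.

Lemma range_base_killed (k : K) e : acts (ls' e) (<< k *g range_base >> : V) = 0.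
Proof. by rewrite act_s'E partial_linUc. Qed.

Lemma act_p_base (A : gvertex G) (k : K) :
  acts (lp A) (<< k *g range_base >> : V) =
  if `[< up_rng x `<=` A >] then << k *g range_base >> else 0.
Proof. by rewrite act_pE partial_linUc /= /rb_p /up_src_in /=; case: asboolP. Qed.

Lemma range_gset : genset (up_rng x). Proof. by case: hx => -[]. Qed.

Lemma act_p_range (k : K) :
  acts (lp (GVertex range_gset)) (<< k *g range_base >> : V) = << k *g range_base >>.
Proof. by rewrite act_p_base; case: asboolP => // -[]. Qed.

Lemma range_base_neq0 : (<< range_base >> : V) <> 0.
Proof.
by apply/eqP; rewrite -[_ == _]/(<< range_base >> == 0 :> {malg K[rb]}) malgU1_neq0.
Qed.

(** Operators [s_e^*] shorten a nonzero vector until it is a nonzero multiple of [range_base]; the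
    [s_e] rebuild every basis vector from it. *)
Lemma range_simple : simple V.
Proof.
split.
  exists (lp (GVertex range_gset)), << range_base >>.
  rewrite -[lm_act _ _]/(acts (lp (GVertex range_gset)) _) act_p_range.
  exact: range_base_neq0.
move=> N hN; case: (pselect (N = [set 0])) => N0; [by left|right].
have [u Nu u0] : exists2 u, N u & u <> 0.
  apply: contrapT => h; apply: N0; apply/seteqP; split=> [u Nu|_ ->].
    by apply: contrapT => u0'; apply: h; exists u.
  by case: hN.
have [_ _ Na] := hN.
have [k Nk k0] : exists2 k, N << k *g range_base >> & k != 0.
  have [n] := shorter_ex u; elim: n u Nu u0 => [|n IH] u Nu u0 su.
    by case: u0; exact: shorter0.
  case: (pselect (forall e, acts (ls' e) u = 0)) => [/killed_range_base[k uk]|].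
    exists k; first by rewrite -uk.
    by apply/eqP => k0; apply: u0; rewrite uk k0; exact: malgU0.
  move=> /existsNP[e eu]; apply: (IH (acts (ls' e) u)) => //; first exact: Na.
  exact: shorter_s'.
have Nb c (y : rb) : N << c *g y >>.
  move: {2}(up_seq y) (erefl (up_seq y)) => l; elim: l y => [|e l IH] y yl.
    have -> : y = range_base by apply: rbasis_eq.
    have -> : << c *g range_base >> =
        acts ((c / k) *: lp (GVertex range_gset)) (<< k *g range_base >> : V).
      rewrite act_scale act_p_range [in LHS]malgUZ [in RHS]malgUZ scalerA.
      by rewrite divfK.
    exact: Na.
  have sy : rb_s' e y = Some (rb_tail y) by apply/rb_s'P; rewrite yl /= yl.
  have -> : << c *g y >> = acts (ls e) (<< c *g rb_tail y >> : V).
    by rewrite act_sE partial_linUc /=; have /rb_ss' -> := sy.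
  by apply: Na; apply: IH; rewrite /= yl.
apply/seteqP; split=> // v _.
rewrite -[v]/(v : {malg K[rb]}) [(v : {malg K[rb]})]monalgE.
elim/big_ind: _ => [|a b|y _]; last exact: Nb.
- by case: hN.
- by move=> ha hb; exact: (submoduleD (M := V) hN).
Qed.

End OneRange.

(** The image of the base vector is killed by all [s_e^*], hence a multiple of the base vector for
    [y]. It is also fixed by the projection at [up_rng x], which annihilates that vector unless the
    inclusion holds. *)
Lemma range_iso_sub (x y : upath G) (hx : Yinf x) (hy : Yinf y) :
  isomorphic (V_range K hx) (V_range K hy) -> up_rng y `<=` up_rng x.
Proof.
move=> [phi [D L /bij_inj inj]].
set b : V_range K hx := << range_base hx >>.
have [|k pk] := killed_range_base (hx := hy) (u := phi b).
  move=> e; rewrite /acts -L -[lm_act _ _]/(acts (ls' e) b).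
  by rewrite range_base_killed (hom0 D).
have : acts (lp (GVertex (range_gset hx))) (phi b) = phi b.
  by rewrite /acts -L -[lm_act _ _]/(acts (lp _) b) act_p_range.
rewrite pk act_p_base; case: asboolP => // _ p0.
by case: (@range_base_neq0 x hx); apply: inj; rewrite (hom0 D) -[LHS]/(phi b) pk -p0.
Qed.

End Range.

(** * The modules spanned by a tail class of infinite paths *)

Section Tail.
Context {K : fieldType} {G : ultragraph} (p : ipath G).
Notation V := (V_tail K p).
Notation tb := (tbasis p).

Definition tail_base : tb := TBasis (ipeq_refl p).

Lemma tail_germ (c : K) (y : tb) : germ y (<< c *g y >> : V).
Proof.
apply: (germ_basis (T := tail_action p) (pth := @tb_path G p)) => {}y.
by exists (TBasis (ip_class_tau 1 (tb_class y))) => //; apply/tb_s'P.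
Qed.

Definition tail_line : set V := [set u | exists k, u = << k *g tail_base >>].

Lemma tail_line0 : tail_line 0.
Proof. by exists 0; exact/esym/malgU0. Qed.

Lemma tail_concentrated : concentrated p tail_line.
Proof.
move=> u; rewrite -[u]/(u : {malg K[tb]}) [(u : {malg K[tb]})]monalgE.
elim/big_ind: _ => [|a b|y _]; first exact: germ_sum0.
- apply: germ_sumD; first exact: tail_line0.
  move=> _ _ [k ->] [l ->]; exists (k + l).
  by rewrite 3!malgUZ scalerDl.
- apply: (germ_sum_germ (q := y)); [exact: tb_class|exact: tail_germ|].
  move=> yp; have -> : y = tail_base by exact: tbasis_eq.
  by exists ((u : {malg K[tb]})@_tail_base).
Qed.

Lemma tail_germ_neq0 : exists u : V, germ p u /\ u <> 0.
Proof.
exists << tail_base >>; split; first exact: (tail_germ 1 tail_base).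
by apply/eqP; rewrite -[_ == _]/(<< tail_base >> == 0 :> {malg K[tb]}) malgU1_neq0.
Qed.

Lemma tail_simple : simple V.
Proof.
apply: (simple_concentrated tail_concentrated tail_germ_neq0) => u v gu u0 gv.
have [/(_ erefl)[k uk] _] := concentrated_germ tail_line0 tail_concentrated gu.
have [/(_ erefl)[l ->] _] := concentrated_germ tail_line0 tail_concentrated gv.
have k0 : k != 0.
  by apply/eqP => k0; apply: u0; rewrite uk k0; exact: malgU0.
(* The projection at the source of [p] fixes the basis vector [p], so its multiple by [l / k] sends
   [k p] to [l p]. *)
exists ((l / k) *: lp (gv1 (ip_src p))).
rewrite uk act_scale act_pE partial_linUc /= /tb_p /=; case: asboolP => [_|[]//].
by rewrite [in LHS]malgUZ [in RHS]malgUZ scalerA divfK.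
Qed.

End Tail.

(** * Laurent polynomials *)

(* [d] is a greatest common divisor of [t * f] and [s * g], where [t], [s] are
   units. *)
Lemma bezout_irreducible (R : comNzRingType) (f g t t' s s' p q d u v : R) :
  t' * t = 1 -> s' * s = 1 -> t * f = p * d -> s * g = q * d ->
  u * (t * f) + v * (s * g) = d ->
  irreducible_elt f -> ~ (exists h, g = h * f) -> exists a b, a * f + b * g = 1.
Proof.
move=> tt ss fd gd dE [_ _ irr] nfg.
have fE : f = t' * p * d by rewrite -mulrA -fd mulrA tt mul1r.
have gE : g = s' * q * d by rewrite -mulrA -gd mulrA ss mul1r.
(* If [t' * p] is a unit, then [f] divides [d] and hence [g]; otherwise [d] is a unit, and the
   relation [dE] is divided by it. *)
have [[w hw]|[e de]] := irr _ _ fE.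
  case: nfg; exists (s' * q * w).
  by rewrite [in RHS]fE {1}gE -[RHS]mulrA [w * _]mulrA [w * _]mulrC hw mul1r.
exists (e * u * t), (e * v * s).
by rewrite -!mulrA -mulrDr dE mulrC.
Qed.

(** In [g = h * f] the factor [f] is not a unit, so [h] is one, which makes [f] and [g]
    associate. *)
Lemma irreducible_associate (R : comNzRingType) (f g : R) :
  irreducible_elt f -> irreducible_elt g -> ~ associate f g ->
  ~ (exists h, g = h * f).
Proof.
move=> [_ nuf _] [_ _ irr] nfg [h gE].
case: (irr h f gE) => [[k hk]|//]; apply: nfg; exists k; split.
  by exists h; rewrite mulrC.
by rewrite gE mulrA [k * h]mulrC hk mul1r.
Qed.

Lemma associate_sym (R : comNzRingType) (f g : R) : associate f g -> associate g f.
Proof.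
move=> [u [[v uv] ->]]; exists v; split; first by exists u; rewrite mulrC.
by rewrite mulrA [v * u]mulrC uv mul1r.
Qed.

Section LaurentRing.
Context (K : fieldType).
Local Notation L := (laurent K).

Lemma lextUc (T : choiceType) (V : lmodType K) (f : T -> V) (a : K) y :
  lext f << a *g y >> = a *: f y.
Proof. by rewrite malgUZ linearZ /= lextU. Qed.

Lemma laurent_mulU (a b : K) (i j : int) :
  (<< a *g i >> : L) * (<< b *g j >> : L) = << a * b *g i + j >>.
Proof.
rewrite -[LHS]/(laurent_mul _ _) laurent_mulE lextUc lextUc scalerA.
by rewrite -malgUZ.
Qed.

Definition laurent_const (k : K) : L := << k *g 0 >>.

Fact laurent_const_zmod : zmod_morphism laurent_const.
Proof.
move=> a b; rewrite /laurent_const; apply/malgP => i.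
by rewrite mcoeffB !mcoeffU mulrnBl.
Qed.

Fact laurent_const_monoid : monoid_morphism laurent_const.
Proof. by split=> // a b; rewrite laurent_mulU addr0. Qed.

HB.instance Definition _ :=
  GRing.isZmodMorphism.Build K L laurent_const laurent_const_zmod.
HB.instance Definition _ :=
  GRing.isMonoidMorphism.Build K L laurent_const laurent_const_monoid.

Definition laurent_X : L := << 1 >>.

Fact laurent_X_comm : commr_rmorph laurent_const laurent_X.
Proof. by move=> k; exact: mulrC. Qed.

Definition laurent_of_poly : {poly K} -> L := horner_morph laurent_X_comm.
HB.instance Definition _ := GRing.RMorphism.on laurent_of_poly.

Lemma laurent_of_polyXn n : laurent_of_poly 'X^n = << n%:Z >>.
Proof.
rewrite rmorphXn /= /laurent_of_poly horner_morphX.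
elim: n => [|n IH] //; rewrite exprS IH laurent_mulU mulr1.
by rewrite -PoszD add1n.
Qed.

Lemma laurent_scale (c : K) (g : L) :
  c *: (g : {malg K[int]}) = laurent_const c * g :> L.
Proof.
rewrite -[RHS]/(laurent_mul _ _) laurent_mulE lextUc; congr (_ *: _).
by have := laurent_mul1 g; rewrite laurent_mulE lextU => ->.
Qed.

Lemma laurent_mon_add (m n : nat) :
  << (m + n)%:Z >> = (<< m%:Z >> : L) * (<< n%:Z >> : L) :> L.
Proof. by rewrite laurent_mulU mulr1 PoszD. Qed.

Fact laurent_polyD (x y : L) n m P Q :
  (<< n%:Z >> : L) * x = laurent_of_poly P ->
  (<< m%:Z >> : L) * y = laurent_of_poly Q ->
  (<< (n + m)%:Z >> : L) * (x + y) = laurent_of_poly ('X^m * P + 'X^n * Q).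
Proof.
move=> xP yQ.
have -> : laurent_of_poly ('X^m * P + 'X^n * Q) =
   laurent_of_poly 'X^m * laurent_of_poly P + laurent_of_poly 'X^n * laurent_of_poly Q.
  by rewrite rmorphD; congr (_ + _); exact: rmorphM.
rewrite !laurent_of_polyXn -xP -yQ laurent_mon_add.
have C (R : comNzRingType) (a b u v : R) : a * b * (u + v) = b * (a * u) + a * (b * v).
  by rewrite mulrDr !mulrA [b * a]mulrC.
exact: C.
Qed.

Fact laurent_polyZ (x : L) c n P :
  (<< n%:Z >> : L) * x = laurent_of_poly P ->
  (<< n%:Z >> : L) * (laurent_const c * x) = laurent_of_poly (c%:P * P).
Proof.
move=> xP.
have -> : laurent_of_poly (c%:P * P) = laurent_of_poly c%:P * laurent_of_poly P.
  exact: rmorphM.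
by rewrite -xP /laurent_of_poly horner_morphC; exact: mulrCA.
Qed.

(** A high power of [t] clears the negative exponents; this reduces the Bezout identity to
    polynomials. *)
Lemma laurent_poly (g : L) : exists n P, (<< n%:Z >> : L) * g = laurent_of_poly P.
Proof.
move: g; apply: (malg_ind (R := K) (T := int)) =>
  [|x y [n [P xP]] [m [Q yQ]]|c x [n [P xP]]|].
- by exists 0%N, 0; rewrite mulr0 rmorph0.
- by exists (n + m)%N, ('X^m * P + 'X^n * Q); exact: laurent_polyD.
- by exists n, (c%:P * P); rewrite laurent_scale; exact: laurent_polyZ.
- case=> i.
    by exists 0%N, 'X^i; rewrite laurent_of_polyXn laurent_mulU mulr1 add0r.
  by exists i.+1, 1; rewrite rmorph1 laurent_mulU mulr1 NegzE subrr.
Qed.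

Lemma laurent_bezout (f g : L) : irreducible_elt f -> ~ (exists h, g = h * f) ->
  exists a b, a * f + b * g = 1.
Proof.
have [n [P fP]] := laurent_poly f; have [m [Q gQ]] := laurent_poly g.
have [[u v] /= uv] := Bezoutp P Q.
(* [D] is a gcd of [P] and [Q]; since powers of [t] are units, it serves for [f] and [g] as well. *)
set D := u * P + v * Q in uv.
have /dvdpP[p PD] : D %| P by rewrite (eqp_dvdl _ uv) dvdp_gcdl.
have /dvdpP[q QD] : D %| Q by rewrite (eqp_dvdl _ uv) dvdp_gcdr.
have inv (i : nat) : (<< - i%:Z >> : L) * (<< i%:Z >> : L) = 1.
  by rewrite laurent_mulU mulr1 addNr.
have fE : (<< n%:Z >> : L) * f = laurent_of_poly p * laurent_of_poly D.
  by rewrite fP PD; exact: rmorphM.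
have gE : (<< m%:Z >> : L) * g = laurent_of_poly q * laurent_of_poly D.
  by rewrite gQ QD; exact: rmorphM.
apply: (bezout_irreducible (u := laurent_of_poly u) (v := laurent_of_poly v)
  (inv n) (inv m) fE gE).
rewrite fP gQ /D rmorphD.
by congr (_ + _); exact/esym/rmorphM.
Qed.

End LaurentRing.

(** * Rational paths *)

Section CyclePeriods.
Context {G : ultragraph}.
Implicit Types (c : ug_cycle G) (q : ipath G).

Lemma cy_inf_addM c i k : cy_inf c (i + k * cy_len c)%N = cy_inf c i.
Proof. by rewrite /= /cy_nth addnC modnMDl. Qed.

(** The first [r] edges form the cycle; it closes up because [q r] is again [q 0]. *)
Lemma periodic_cycle q r : (0 < r)%N -> tau r q = q ->
  exists2 d : ug_cycle G, cy_len d = r & cy_inf d = q.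
Proof.
case: r => // r _ qr.
have per i : q (r.+1 + i)%N = q i by rewrite -[in RHS]qr.
pose l := map q (iota 1 r).
have nthE j : (j <= r)%N -> nth (q 0%N) (q 0%N :: l) j = q j.
  by move=> jr; rewrite -[q 0%N :: l]/(mkseq q r.+1) nth_mkseq.
have pl : path (@adj G) (q 0%N) l.
  apply/(pathP (q 0%N)) => i; rewrite size_map size_iota => ir.
  rewrite nthE 1?ltnW // -[nth _ l i]/(nth (q 0%N) (q 0%N :: l) i.+1) nthE //.
  by apply/asboolP; exact: ip_ok.
have cl : rng (last (q 0%N) l) (source (q 0%N)).
  have -> : last (q 0%N) l = q r.
    rewrite -[LHS]/(last (q 0%N) (q 0%N :: l)) -nth_last nthE /= size_map size_iota //.
  by rewrite -(per 0%N) addn0; exact: ip_ok.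
exists (UgCycle pl cl); first by rewrite /cy_len /= size_map size_iota.
apply: ipath_eq => i; rewrite /= /cy_nth /cy_len /= size_map size_iota.
rewrite nthE; last by rewrite -ltnS ltn_pmod.
rewrite [in RHS](divn_eq i r.+1) addnC; elim: (i %/ r.+1)%N => [|k ->].
  by rewrite addn0.
by rewrite mulSn addnCA per.
Qed.

Definition shortest_cycle c : Prop :=
  forall d, ipeq (cy_inf c) (cy_inf d) -> (cy_len c <= cy_len d)%N.

(** The remainder of [m - n] modulo the length of [c] is again a period of c^oo; were it positive,
    it would give a shorter cycle. *)
Lemma shortest_period c m n : shortest_cycle c -> (n <= m)%N ->
  tau m (cy_inf c) = tau n (cy_inf c) -> (cy_len c %| m - n)%N.
Proof.
move=> hc nm eqt; set L := cy_len c.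
have L0 : (0 < L)%N by [].
(* Equal tails give the period only from index [n] on; adding [n] lengths of [c] moves every index
   there. *)
have per i : cy_inf c (m - n + i)%N = cy_inf c i.
  rewrite -(cy_inf_addM c i n) -(cy_inf_addM c (m - n + i) n) -/L.
  have nL : (n <= i + n * L)%N by rewrite (leq_trans (leq_pmulr n L0)) // leq_addl.
  have e : cy_inf c (m + (i + n * L - n))%N = cy_inf c (n + (i + n * L - n))%N.
    exact: (congr1 (fun q : ipath G => q (i + n * L - n)%N) eqt).
  rewrite (subnKC nL) in e; rewrite -[RHS]e; congr (cy_inf c _).
  by rewrite -[in RHS](subnK nm) -[in RHS]addnA (subnKC nL) addnA.
have rE : tau ((m - n) %% L) (cy_inf c) = cy_inf c.
  apply: ipath_eq => i; rewrite -[RHS]per.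
  rewrite -[LHS]/(cy_inf c _) -(cy_inf_addM c _ ((m - n) %/ L)) -/L.
  by congr (cy_inf c _); rewrite [in RHS](divn_eq (m - n) L) -[RHS]addnA [RHS]addnC.
rewrite /dvdn; case: posnP => // r0.
have [d dL dE] := periodic_cycle r0 rE.
have := hc d; rewrite dE dL leqNgt ltn_pmod // => /(_ (ipeq_refl _)).
by [].
Qed.

Definition cycle_base c : cbasis c :=
  @CBasis G c (cy_inf c) 0
    (conj (ipeq_refl _) (ex_intro _ 0%N (ex_intro _ 0%N (conj erefl erefl)))).

(** Minimality of [c] makes every degree over c^oo a multiple of its length, so these triples form a
    single orbit under powers of [t]. *)
Lemma shortest_shift c (y : cbasis c) : shortest_cycle c ->
  cb_path y = cy_inf c -> exists j, y = cb_shift j (cycle_base c).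
Proof.
move=> hc yc; have [_ [m [n [kE]]]] := cb_ok y; rewrite yc => eqt.
suff [j jE] : exists j, cb_deg y = j * (cy_len c)%:Z.
  by exists j; apply: cbasis_eq; rewrite ?yc //= add0r.
have [nm|/ltnW mn] := leqP n m.
  have /dvdnP[j jE] := shortest_period hc nm eqt.
  by exists j%:Z; rewrite kE subzn // jE PoszM.
have /dvdnP[j jE] := shortest_period hc mn (esym eqt).
by exists (- j%:Z); rewrite kE -opprB subzn // jE PoszM mulNr.
Qed.

End CyclePeriods.

Lemma span_multiple (R : comNzRingType) (f v : R) :
  @Defs.span R R^o [set f] v -> exists a, v = a * f.
Proof.
elim=> {v} [v ->||u v _ [a ->] _ [b ->]|a v _ [b ->]].
- by exists 1; rewrite mul1r.
- by exists 0; rewrite mul0r.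
- by exists (a + b); rewrite mulrDl.
- by exists (a * b); rewrite -[_ *: _]/(a * (b * f)) mulrA.
Qed.

(** * Pure tensors and balanced maps *)

Section TensorFunctional.
Context {R : comNzRingType} {M N P : lmodType R}.

Lemma tpureDr (m : M) (n n' : N) : tpure m (n + n') = tpure m n + tpure m n'.
Proof. rewrite /tpure -linearD; apply/qpiP; exact/span_gen/tensor_Dr. Qed.

Lemma tpureZ (m : M) a (n : N) : tpure (a *: m) n = tpure m (a *: n).
Proof. apply/qpiP; exact/span_gen/tensor_bal. Qed.

Lemma tpurel0 (n : N) : tpure (0 : M) n = 0.
Proof. by apply: (addrI (tpure 0 n)); rewrite -tpureDl !addr0. Qed.

Lemma tpurer0 (m : M) : tpure m (0 : N) = 0.
Proof. by apply: (addrI (tpure m 0)); rewrite -tpureDr !addr0. Qed.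

Lemma tpurerN (m : M) (n : N) : tpure m (- n) = - tpure m n.
Proof. by apply: (addrI (tpure m n)); rewrite -tpureDr !subrr tpurer0. Qed.

(** A balanced biadditive map factors through the tensor product, and can thus detect nonzero pure
    tensors. *)
Lemma tpure_eq0 (beta : M -> N -> P) (m : M) (n : N) :
  (forall n, {morph beta^~ n : x y / x + y}) ->
  (forall m, {morph beta m : x y / x + y}) ->
  (forall m a n, beta (a *: m) n = beta m (a *: n)) ->
  tpure m n = 0 -> beta m n = 0.
Proof.
move=> bDl bDr bZ; rewrite -[0](linear0 (qpi (@tensor_rel R M N))) => /qpiP.
(* The tensor product is a quotient of a free abelian group, so the target is viewed as a module
   over the integers. *)
pose ext : {malg int[(M * N)%type]} -> zmodule P :=
  lext (fun z => beta z.1 z.2 : zmodule P).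
have extU m' n' : ext << (m', n') >> = beta m' n' by exact: lextU.
have extD u v : ext (u + v) = ext u + ext v by exact: linearD.
have extB u v : ext (u - v) = ext u - ext v by exact: linearB.
rewrite subr0 -[beta m n]extU; elim=> {m n} [_ []|||].
- by move=> m m' n; rewrite extB extD !extU bDl; exact: subrr.
- by move=> m n n'; rewrite extB extD !extU bDr; exact: subrr.
- by move=> m a n; rewrite extB !extU bZ; exact: subrr.
- by rewrite /ext linear0.
- by move=> u v _ hu _ hv; rewrite extD hu hv; exact: addr0.
- move=> a v _ hv; have -> : ext (a *: v) = a *: ext v by exact: linearZ.
  by rewrite (hv : ext v = 0 :> zmodule P) scaler0.
Qed.

End TensorFunctional.

(** * The modules of rational paths: action along c^oo *)

Section Rational.
Context {K : fieldType} {G : ultragraph} (c : ug_cycle G).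
Local Notation L := (laurent K).
Local Notation x0 := (<< cycle_base c >> : Mc K c).

Lemma Mc_scaleU (a k : K) (i : int) (y : cbasis c) :
  (<< a *g i >> : L) *: (<< k *g y >> : Mc K c) = << a * k *g cb_shift i y >>.
Proof.
rewrite -[LHS]/(shift_scale (@cb_shift G c) << a *g i >> << k *g y >>).
rewrite /shift_scale lextUc malgUZ linearZ /= shift_linU scalerA.
by rewrite -malgUZ.
Qed.

Lemma Mc_germ (k : K) (y : cbasis c) : germ (cb_path y) (<< k *g y >> : Mc_module K c).
Proof.
apply: (germ_basis (T := cycle_action c) (pth := @cb_path G c)) => {}y.
exists (CBasis (cb_tail_ok y)) => //.
by apply/cb_s'P; split=> //=; rewrite subrK.
Qed.

Lemma Mc_peel (k : K) (y : cbasis c) n :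
  exists z, [/\ peel (cb_path y) n (<< k *g y >> : Mc_module K c) = << k *g z >>,
    cb_path z = tau n (cb_path y) & cb_deg z = cb_deg y - n%:Z].
Proof.
elim: n => [|n [z [zE zn zd]]].
  by exists y; rewrite subr0; split=> //; exact: ipath_eq.
exists (CBasis (cb_tail_ok z)); split.
- have sz : cb_s' (cb_path y n) z = Some (CBasis (cb_tail_ok z)).
    by apply/cb_s'P; split=> //=; rewrite ?zn /= ?addn0 ?subrK.
  by rewrite /= zE (act_s'E (T := cycle_action c)) partial_linUc /= sz.
- by rewrite /= zn tau_add addn1.
- by rewrite /= zd -addn1 PoszD opprD addrA.
Qed.

Lemma act_peel (M : lmodule (@leavitt_rel K G)) q n (u : M) :
  germ q u -> exists a, peel q n u = acts a u.
Proof.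
move=> gu; elim: n => [|n [a aE]].
  (* For [n = 0] an element fixing [u] is needed; the germ condition at index 0 provides
     [s_{q 0} s_{q 0}^*]. *)
  exists (pmul (ls (q 0%N)) (ls' (q 0%N))).
  by rewrite /acts lm_actA; exact/esym/(gu 0%N).
by exists (pmul (ls' (q n)) a); rewrite /= aE /acts lm_actA.
Qed.

Lemma act_unpeel (M : lmodule (@leavitt_rel K G)) q n (u : M) :
  germ (tau n q) u -> exists a, unpeel q n u = acts a u.
Proof.
elim: n u => [|n IH] u gu.
  by have [a aE] := act_peel 0 gu; exists a.
have [|a aE] := IH (acts (ls (q n)) u).
  have := (unpeelK (q := tau n q) (n := 1) (u := u) _).1.
  by rewrite tau_add addn1 /= addn0; apply.
by exists (pmul a (ls (q n))); rewrite /acts lm_actA.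
Qed.

(** Copies of the cycle realize the powers of [t]: they are prepended for [i >= 0] and removed for
    [i < 0]. *)
Lemma act_shift (i : int) :
  exists a : leavitt K G, Mc_act a x0 = << cb_shift i (cycle_base c) >>.
Proof.
have shiftE (y : cbasis c) : cb_path y = cy_inf c -> cb_deg y = i * (cy_len c)%:Z ->
    y = cb_shift i (cycle_base c).
  by move=> yc yd; apply: cbasis_eq; rewrite ?yc //= yd add0r.
have per j : tau (j * cy_len c) (cy_inf c) = cy_inf c.
  by apply: ipath_eq => k; rewrite -[LHS]/(cy_inf c _) addnC cy_inf_addM.
case: i shiftE => j shiftE.
  pose y := cb_shift j (cycle_base c).
  have [z [zE zn zd]] := Mc_peel 1 y (j * cy_len c).
  have z0 : z = cycle_base c.
    by apply: cbasis_eq; rewrite ?zn ?per // zd /= add0r PoszM subrr.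
  have gz : germ (tau (j * cy_len c) (cy_inf c)) (x0 : Mc_module K c).
    by rewrite per; exact: (Mc_germ 1 (cycle_base c)).
  have [a aE] := act_unpeel gz.
  exists a; rewrite -[LHS]/(acts (M := Mc_module K c) a x0) -aE.
  rewrite z0 in zE; rewrite -[x0]zE -[RHS]/(<< y >> : {malg K[_]}).
  exact: (peelK _ (Mc_germ 1 y)).
(* Here [i] is [Negz j], that is [-(j + 1)], so [j + 1] copies of [c] are removed. *)
have [z [zE zn zd]] := Mc_peel 1 (cycle_base c) (j.+1 * cy_len c).
have [a aE] := act_peel (j.+1 * cy_len c) (Mc_germ 1 (cycle_base c)).
exists a; rewrite -[LHS]/(acts (M := Mc_module K c) a x0) -aE [LHS]zE.
congr << _ >>; apply: shiftE; first by rewrite zn per.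
by rewrite zd /= add0r NegzE mulNr PoszM.
Qed.

Lemma Mc_scale_const (k : K) (x : Mc K c) :
  (laurent_const k : L) *: x = (k *: (x : {malg K[cbasis c]}) : Mc K c).
Proof.
rewrite -[LHS]/(shift_scale (@cb_shift G c) << k *g 0 >> x) /shift_scale lextUc.
by rewrite shift_lin0 //; exact: cb_shift0.
Qed.

Lemma act_laurent (g : L) : exists a : leavitt K G, Mc_act a x0 = g *: x0.
Proof.
move: g; apply: (malg_ind (R := K) (T := int)) => [|g h [a ga] [b hb]|k g [a ga]|i].
- by exists 0; rewrite scale0r; apply: (addrI (Mc_act 0 x0)); rewrite -Mc_actDl !addr0.
- by exists (a + b); rewrite Mc_actDl ga hb -scalerDl.
- exists (k *: a); rewrite laurent_scale -scalerA -ga.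
  rewrite Mc_scale_const -[LHS]/(acts (M := Mc_module K c) (k *: a) x0).
  exact: (act_scale (T := cycle_action c)).
- have [a aE] := act_shift i; exists a.
  by rewrite aE Mc_scaleU mulr1.
Qed.

(** * The factor modules V^f over c^oo *)

Section Factor.
Context (f : L).
Local Notation F := (laurent_mod f).
Local Notation V := (V_rational c f).
Local Notation pure := (tpure (M := Mc K c) (N := F)).

Definition class_mod (g : L) : F := qpi (V := L^o) [set f] (g : L^o).
Local Notation pi := class_mod.

Lemma class_modW (P : F -> Prop) : (forall g, P (pi g)) -> forall n, P n.
Proof. by move=> h; apply: Defs.quotW. Qed.

Lemma act_pure a m n : lm_act (l := V) a (pure m n) = pure (Mc_act a m) n.
Proof. exact: tmap_pure. Qed.

Lemma pure_germ q (m : Mc_module K c) n : germ q m -> germ q (pure m n : V).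
Proof.
apply: (germ_hom (phi := fun m : Mc_module K c => (pure m n : V))) => a u.
exact/esym/act_pure.
Qed.

Definition base_line : set V := [set u | exists n, u = pure x0 n].

Lemma base_line0 : base_line 0. Proof. by exists 0; exact/esym/tpurer0. Qed.

Lemma base_lineD u v : base_line u -> base_line v -> base_line (u + v).
Proof. by move=> [m ->] [n ->]; exists (m + n); exact/esym/tpureDr. Qed.

Lemma base_lineN u : base_line u -> base_line (- u).
Proof. by move=> [m ->]; exists (- m); exact/esym/tpurerN. Qed.

(** Over c^oo every triple is a power of [t] applied to the base one, and this power moves across
    the tensor sign. *)
Lemma rational_concentrated : shortest_cycle c -> concentrated (cy_inf c) base_line.
Proof.
move=> hc; apply: tensor_ind => [m n||x y|x].
- rewrite -[m]/(m : {malg K[cbasis c]}) [(m : {malg K[cbasis c]})]monalgE.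
  elim/big_ind: _ => [|x y hx hy|y _].
  + by rewrite tpurel0; exact: germ_sum0.
  + by rewrite tpureDl; apply: germ_sumD => //; [exact: base_line0|exact: base_lineD].
  apply: (germ_sum_germ (q := cb_path y)); first by case: (cb_ok y).
    exact/pure_germ/Mc_germ.
  move=> /(shortest_shift hc)[j ->]; set k := m@_ _.
  by exists ((<< k *g j >> : L) *: n); rewrite -tpureZ Mc_scaleU mulr1.
- exact: germ_sum0.
- by apply: germ_sumD; [exact: base_line0|exact: base_lineD].
- by apply: germ_sumN; exact: base_lineN.
Qed.

Lemma base_germ n : germ (cy_inf c) (pure x0 n : V).
Proof. exact/pure_germ/(Mc_germ 1 (cycle_base c)). Qed.

(* The coordinate along [c^oo]: the vector [(c^oo, j |c|, c^oo)] is sent to [t^j]. *)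
Definition base_coord (x : Mc K c) : L :=
  lext (fun y : cbasis c => if `[< cb_path y = cy_inf c >]
    then << (cb_deg y %/ cy_len c)%Z >> else 0) x.

Lemma base_coordD : {morph base_coord : x y / x + y}.
Proof. by move=> x y; exact: linearD. Qed.

Lemma base_coord0 : base_coord 0 = 0.
Proof. exact: linear0. Qed.

Lemma base_coordU (k : K) y : base_coord << k *g y >> =
  if `[< cb_path y = cy_inf c >] then << k *g (cb_deg y %/ cy_len c)%Z >> else 0.
Proof.
rewrite /base_coord lextUc; case: asboolP => _; last exact: scaler0.
exact/esym/malgUZ.
Qed.

Lemma base_coordZ (g : L) x : base_coord (g *: x) = g * base_coord x.
Proof.
rewrite [g]monalgE; elim/big_ind: _ => [|a b ha hb|i _].
- by rewrite scale0r mul0r base_coord0.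
- by rewrite scalerDl base_coordD ha hb mulrDl.
rewrite -[x]/(x : {malg K[cbasis c]}) [(x : {malg K[cbasis c]})]monalgE.
elim/big_ind: _ => [|a b ha hb|y _].
- by rewrite scaler0 base_coord0 mulr0.
- by rewrite scalerDr !base_coordD ha hb mulrDr.
(* Adding [i * cy_len c] to the degree adds exactly [i] to the floor quotient, matching
   multiplication by [t^i]. *)
rewrite Mc_scaleU !base_coordU /=; case: asboolP => _; last by rewrite mulr0.
by rewrite laurent_mulU addrC divzMDl.
Qed.

(** The balanced map taking [m] and [n] to [base_coord m *: n] sends this tensor to the class of 1,
    nonzero because [f] is not a unit. *)
Lemma base_neq0 : ~ is_unit f -> pure x0 (pi 1) <> 0.
Proof.
move=> nuf /(tpure_eq0 (beta := fun m (n : F) => base_coord m *: n)) h.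
have {}h : base_coord x0 *: pi 1 = 0.
  apply: h => [n x y|m n n'|m a n].
  - by rewrite base_coordD scalerDl.
  - by rewrite scalerDr.
  - by rewrite base_coordZ scalerA mulrC.
have b0 : base_coord x0 = 1.
  by rewrite /base_coord lextU /=; case: asboolP => // _; rewrite div0z.
move: h; rewrite b0 scale1r -(linear0 (qpi (V := L^o) [set f])) => /qpiP.
rewrite subr0 => /span_multiple[a ha]; apply: nuf; exists a.
by rewrite mulrC -ha.
Qed.

Lemma piZ (a g : L) : a *: pi g = pi (a * g).
Proof. exact/esym/(linearZ_LR (qpi (V := L^o) [set f])). Qed.

Lemma pi_multiple (h : L) : pi (h * f) = 0.
Proof.
rewrite -(linear0 (qpi (V := L^o) [set f])); apply/qpiP; rewrite subr0.
exact/(@span_Z L L^o [set f] h f)/span_gen.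
Qed.

Lemma factor_ann (n : F) : f *: n = 0.
Proof. by move: n; apply: class_modW => g; rewrite piZ mulrC pi_multiple. Qed.

Lemma factor_inverse (a g : L) (n : F) : (exists b, b * f + a * g = 1) ->
  n = a *: (g *: n).
Proof.
move=> [b ab]; rewrite -[LHS]scale1r -ab scalerDl -scalerA factor_ann scaler0.
by rewrite add0r scalerA.
Qed.

Lemma act_base (g : L) : exists a : leavitt K G,
  forall n, acts a (pure x0 n : V) = pure x0 (g *: n).
Proof.
have [a aE] := act_laurent g; exists a => n.
by rewrite /acts act_pure aE tpureZ.
Qed.

Lemma rational_germ_neq0 :
  ~ is_unit f -> exists u : V, germ (cy_inf c) u /\ u <> 0.
Proof.
by move=> nuf; exists (pure x0 (pi 1)); split; [exact: base_germ|exact: base_neq0].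
Qed.

Lemma rational_simple : irreducible_elt f -> shortest_cycle c -> simple V.
Proof.
move=> irr hc; have [_ nuf _] := irr.
have conc := rational_concentrated hc.
apply: (simple_concentrated conc (rational_germ_neq0 nuf)) => u v gu u0 gv.
have [/(_ erefl)[n un] _] := concentrated_germ base_line0 conc gu.
have [/(_ erefl)[n' ->] _] := concentrated_germ base_line0 conc gv.
rewrite un in u0 *; move: n u0 {un gu}; apply: class_modW => g u0.
(* A nonzero [u] rules out that [f] divides [g], so [b] inverts [g] modulo [f], and [g' * b] carries
   the class of [g] to that of [g']. *)
have [|a [b ab]] := @laurent_bezout K f g irr.
  by move=> [h gE]; apply: u0; rewrite gE [X in tpure _ X]pi_multiple tpurer0.
move: n' {gv}; apply: class_modW => g'.
have [d dE] := act_base (g' * b); exists d; rewrite dE; congr tpure.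
rewrite [LHS](factor_inverse (pi g') (ex_intro _ a ab)) !piZ; congr pi.
have C (R : comNzRingType) (x y z : R) : x * (y * z) = z * x * y.
  by rewrite mulrA mulrC mulrA.
exact: C.
Qed.

End Factor.

End Rational.

Lemma rational_not_isomorphic (K : fieldType) (G : ultragraph) (c : ug_cycle G)
    (f g : laurent K) :
  shortest_cycle c -> irreducible_elt f -> irreducible_elt g -> ~ associate f g ->
  ~ isomorphic (V_rational c f) (V_rational c g).
Proof.
move=> hc irrf irrg nfg [phi [D Lin /bij_inj inj]].
have [_ nuf _] := irrf.
pose u : V_rational c f :=
  tpure (M := Mc K c) (N := laurent_mod f) << cycle_base c >> (class_mod f 1).
have gu : germ (cy_inf c) u by exact: base_germ.
have [/(_ erefl)[n pn] _] :=
  concentrated_germ (base_line0 _ _) (rational_concentrated hc) (germ_hom Lin gu).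
apply: (base_neq0 (c := c) nuf); apply: inj; rewrite (hom0 D) -[LHS]/(phi u) pn.
have ngf : ~ associate g f by move=> /associate_sym.
(* [f] is not a multiple of [g], hence invertible modulo [g], with inverse [b]. *)
have [a [b ab]] := laurent_bezout irrg (irreducible_associate irrg irrf ngf).
have [d dE] := act_laurent c f.
(* The element [d] acts on the base vector as [f]; it kills [u], hence also [phi u]. *)
have f0 : tpure (M := Mc K c) (N := laurent_mod g) << cycle_base c >> (f *: n) = 0.
  rewrite -tpureZ -dE -act_pure -pn -Lin act_pure dE tpureZ factor_ann tpurer0.
  exact: (hom0 D).
rewrite (factor_inverse n (ex_intro _ a ab)) -tpureZ.
have [d' dE'] := act_laurent c b.
by rewrite -dE' -act_pure f0 lm_act0.
Qed.

(** * The family *)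

Section Family.
Context {K : fieldType} {G : ultragraph} (cyc : cycle_choice G).

Lemma cyc_shortest (p : rpath G) : shortest_cycle (cyc p).
Proof.
have [pc le] := cyc_min cyc p => d cd; apply: le; exact: ipeq_trans pc cd.
Qed.

Lemma family_simple (i : family_index K G) : simple (lpa_family cyc i).
Proof.
case: i => [x hx|p hp|p f irr] /=; first exact: range_simple.
  exact: tail_simple.
exact: rational_simple irr (@cyc_shortest p).
Qed.

(** A path that carries nonzero germs; the value [None] marks the modules without any. *)
Definition family_path (i : family_index K G) : option (ipath G) :=
  match i with
  | @Index_range _ _ _ _ => None
  | @Index_irrational _ _ p _ => Some p
  | @Index_rational _ _ p _ _ => Some (cy_inf (cyc p))
  end.

Lemma family_concentrated (i : family_index K G) r : family_path i = Some r ->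
  (exists u : lpa_family cyc i, germ r u /\ u <> 0) /\
  exists2 B : set (lpa_family cyc i), B 0 & concentrated r B.
Proof.
case: i => [//|p hp|p f irr] /= [<-]; split.
- exact: tail_germ_neq0.
- exists (@tail_line K G p); [exact: tail_line0|exact: tail_concentrated].
- by apply: rational_germ_neq0; case: irr.
- exists (@base_line K G (cyc p) f); first exact: base_line0.
  exact/rational_concentrated/cyc_shortest.
Qed.

Lemma family_no_germ (i : family_index K G) q (u : lpa_family cyc i) :
  family_path i = None -> germ q u -> u = 0.
Proof. by case: i u => //= x hx u _; exact: range_no_germ. Qed.

Lemma family_path_isomorphic (i j : family_index K G) :
  isomorphic (lpa_family cyc i) (lpa_family cyc j) ->
  match family_path i, family_path j with
  | None, None => True
  | Some p, Some q => ipeq p q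
  | _, _ => False
  end.
Proof.
have Nmix i' j' p : family_path i' = Some p -> family_path j' = None ->
    ~ isomorphic (lpa_family cyc i') (lpa_family cyc j').
  move=> hi hj [phi [D L /bij_inj inj]].
  have [[u [gu u0]] _] := family_concentrated hi.
  by apply/u0/inj; rewrite (hom0 D); exact/(family_no_germ hj)/(germ_hom L gu).
case hi: (family_path i) => [p|]; case hj: (family_path j) => [q|] // iso.
- have [u _] := family_concentrated hi; have [_ [B B0 conc]] := family_concentrated hj.
  by apply: contrapT => npq; exact: concentrated_not_isomorphic conc B0 u npq iso.
- exact: Nmix hi hj iso.
- exact: Nmix hj hi (isomorphic_sym iso).
Qed.

Lemma ipeq_class (p q : ipath G) : ipeq p q -> ip_class p = ip_class q.
Proof.
move=> pq; apply/seteqP; split=> r rp; first exact: ipeq_trans rp pq.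
exact: ipeq_trans rp (ipeq_sym pq).
Qed.

Lemma family_isomorphic (i j : family_index K G) :
  isomorphic (lpa_family cyc i) (lpa_family cyc j) -> same_member i j.
Proof.
move=> iso; have := family_path_isomorphic iso.
case: i iso => [x hx|p hp|p f irrf]; case: j => [y hy|q hq|q g irrg] //= iso pq.
- apply/seteqP; split; last exact: range_iso_sub iso.
  exact: range_iso_sub (isomorphic_sym iso).
- exact: ipeq_class.
- by case: hp; exists (cyc q).
- by case: hq; exists (cyc p); exact: ipeq_sym.
- have [pc _] := cyc_min cyc p; have [qc _] := cyc_min cyc q.
  have {}pq : ipeq p q by exact: ipeq_trans pc (ipeq_trans pq (ipeq_sym qc)).
  split; first exact: ipeq_class.
  (* [cyc] picks one cycle per class, so both modules are built on the same c^oo. *)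
  apply: contrapT => nfg; move: iso; rewrite -(cyc_class cyc pq).
  exact: rational_not_isomorphic (@cyc_shortest p) irrf irrg nfg.
Qed.

End Family.

Theorem theorem4p7 (K : fieldType) (G : ultragraph) (hG : no_sinks G)
    (cyc : cycle_choice G) :
  (forall i : family_index K G, simple (lpa_family cyc i)) /\
  (forall i j : family_index K G, ~ same_member i j ->
     ~ isomorphic (lpa_family cyc i) (lpa_family cyc j)).
Proof.
split; first exact: family_simple.
by move=> i j nij /family_isomorphic.
Qed.
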